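(* Let $\varphi$ be a combinatorially positive $\mathbb{Z}^d$-valuation and let $Z\subset\mathbb{R}^d$ be a $d$-dimensional lattice zonotope. Write $h^{\varphi}(Z)(t)=h_0+h_1t+\cdots+h_dt^d$. Then: (i) if $\varphi$ takes values in $\mathbb{R}$ (with its usual order), the polynomial $h^{\varphi}(Z)(t)$ has only real roots; (ii) if $d$ is even, $h_0\le h_1\le\cdots\le h_{d/2}\ge h_{d/2+1}\ge\cdots\ge h_d$; if $d$ is odd, $h_0\le\cdots\le h_{(d-1)/2}$ and $h_{(d+1)/2}\ge\cdots\ge h_d$.
   Context: A lattice polytope in $\mathbb{R}^d$ is a polytope whose vertices lie in $\mathbb{Z}^d$. A lattice zonotope is a set $\{\sum_{i=1}^n\lambda_iv_i: 0\le\lambda_i\le 1\}$ with $v_1,\dots,v_n\in\mathbb{Z}^d$, translated by an integer vector. A $\mathbb{Z}^d$-valuation is a map $\varphi$ from the set of lattice polytopes in $\mathbb{R}^d$ (including $\emptyset$) to an abelian group $G$ with $\varphi(\emptyset)=0$, $\varphi(P\cup Q)=\varphi(P)+\varphi(Q)-\varphi(P\cap Q)$ whenever $P,Q,P\cup Q,P\cap Q$ are lattice polytopes, and $\varphi(P+x)=\varphi(P)$ for all $x\in\mathbb{Z}^d$. For an $r$-dimensional lattice polytope $P$, $n\mapsto\varphi(nP)$ ($n\ge 0$) is a polynomial of degree at most $r$, and the $h^\ast$-polynomial of $P$ with respect to $\varphi$ is the polynomial $h^{\varphi}(P)(t)$ of degree at most $r$ defined by $\sum_{n\ge0}\varphi(nP)t^n=h^{\varphi}(P)(t)/(1-t)^{r+1}$.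 The valuation $\varphi$ is combinatorially positive if $G$ is a partially ordered abelian group and all coefficients of $h^{\varphi}(P)(t)$ are $\ge 0$ for every lattice polytope $P$. *)

(* Defs.v *)
From HB Require Import structures.
From mathcomp Require Import all_boot all_order all_algebra.
From mathcomp Require Import boolp classical_sets reals.
From mathcomp Require Import complex.

Set Implicit Arguments.
Unset Strict Implicit.
Unset Printing Implicit Defensive.

Import Order.TTheory GRing.Theory Num.Theory.
Local Open Scope classical_set_scope.
Local Open Scope ring_scope.

Section Polytopes.
Variables (R : realType) (d : nat).
Local Notation V := 'rV[R]_d.
Implicit Types (P Q : set V) (x y z : V).

Definition lattice_point x : Prop := forall j, x 0 j \is a Num.int.

Definition conv_hull (n : nat) (p : 'I_n -> V) : set V :=
  [set x | exists a : 'I_n -> R,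
     [/\ forall i, 0 <= a i, \sum_i a i = 1 & x = \sum_i a i *: p i]].

(* The case n = 0 makes the empty set a polytope. *)
Definition polytope P : Prop :=
  exists (n : nat) (p : 'I_n -> V), P = conv_hull p.

Definition vertex P x : Prop :=
  P x /\ forall y z (t : R), P y -> P z -> 0 < t < 1 ->
    x = t *: y + (1 - t) *: z -> y = z.

Definition lattice_polytope P : Prop :=
  polytope P /\ forall x, vertex P x -> lattice_point x.

Definition affine_hull P : set V :=
  [set x | exists (n : nat) (p : 'I_n -> V) (a : 'I_n -> R),
     [/\ forall i, P (p i), \sum_i a i = 1 & x = \sum_i a i *: p i]].

(* No [r] qualifies when [P] is empty. *)
Definition has_dim P (r : nat) : Prop :=
  exists (x0 : V) (U : {vspace V}),
    \dim U = r /\ affine_hull P = [set x | x - x0 \in U].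

Definition lattice_zonotope P : Prop :=
  exists (n : nat) (v : 'I_n -> V) (w : V),
    [/\ forall i, lattice_point (v i), lattice_point w &
        P = [set x | exists a : 'I_n -> R,
               (forall i, 0 <= a i <= 1) /\ x = w + \sum_i a i *: v i]].

Definition dilate (n : nat) P : set V := [set n%:R *: x | x in P].

Definition translate x P : set V := [set y + x | y in P].

(* Valuations are total functions on sets of points; their values outside
   lattice polytopes are unconstrained and never used. *)
Definition Zd_valuation (G : zmodType) (phi : set V -> G) : Prop :=
  [/\ phi set0 = 0,
      forall P Q, lattice_polytope P -> lattice_polytope Q ->
        lattice_polytope (P `|` Q) -> lattice_polytope (P `&` Q) ->
        phi (P `|` Q) = phi P + phi Q - phi (P `&` Q) &
      forall P x, lattice_polytope P -> lattice_point x ->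
        phi (translate x P) = phi P].

(* The coefficient of t^i in (1 - t)^(r+1) * \sum_n phi(n P) t^n.  For a
   Z^d-valuation and an r-dimensional lattice polytope it vanishes for i > r,
   so the h*-polynomial is given by the coefficients with i <= r. *)
Definition hstar (G : zmodType) (phi : set V -> G) P (r i : nat) : G :=
  \sum_(j < i.+1) phi (dilate (i - j) P) *~ ((1 - 'X) ^+ r.+1 : {poly int})`_j.

Definition hstar_poly (phi : set V -> R) P (r : nat) : {poly R} :=
  \poly_(i < r.+1) hstar phi P r i.

(* The h*-polynomial of the empty polytope is 0, whatever r, so leaving the
   empty polytope out (it has no dimension) loses nothing. *)
Definition combinatorially_positive (G : porderZmodType) (phi : set V -> G) :
    Prop :=
  Zd_valuation phi /\
  forall P r, lattice_polytope P -> has_dim P r ->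
    forall i, (i <= r)%N -> 0 <= hstar phi P r i.

End Polytopes.

(* [porderZmodType] does not relate the order to the addition. *)
Definition translation_invariant_order (G : porderZmodType) : Prop :=
  forall x y z : G, x <= y -> x + z <= y + z.

(* The zero polynomial counts as real-rooted, by the usual convention. *)
Definition real_rooted (R : realType) (p : {poly R}) : Prop :=
  p = 0 \/
  forall z : complex R, root (map_poly (real_complex R) p) z -> complex.Im z = 0.

(* Main.v *)
Require Import Defs.
From mathcomp Require Import all_boot all_order all_algebra.
From mathcomp Require Import boolp classical_sets reals.
From mathcomp Require Import complex zify ring lra.

Set Implicit Arguments.
Unset Strict Implicit.
Unset Printing Implicit Defensive.

Import Order.TTheory GRing.Theory Num.Theory.
Local Open Scope classical_set_scope.
Local Open Scope ring_scope.

(* For a zonotope [Z] generated by [v_1], ..., [v_m], let [D_v] be the operator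
   replacing [phi (Q)] by [phi (Q + [0, v]) - phi (Q)].  Two-piece cuts of
   [Q + [0, v] + [0, w]] along hyperplanes give [D_v D_w = D_v D_(v + w)] and
   [D_v ^ 2 = 0].  By Euclid's algorithm a product of operators [D_v] over linearly
   dependent vectors vanishes, and [phi (n Z)] is the product of the [1 + n D_v]
   applied to the value at a point.

   Put [B_v = D_v - 1], so that [1 + n D_v = (n + 1) + n B_v].  For independent
   vectors the product of the [B_v] is the value of [phi] on an open parallelepiped,
   which is the top h*-coefficient of the closed one, hence nonnegative.
   Deletion-contraction on the generators, as for the h-vector of a matroid complex,
   then writes [phi (n Z)] as the sum over [k] of [c_k n ^ k (n + 1) ^ (d - k)] with
   [c_k >= 0].  Hence the h*-polynomial of [Z] is the sum of the [c_k A_(d, k)], where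
   [A_(d, k)] is a refined Eulerian polynomial, the h*-polynomial of the unit
   [d]-cube with [k] facets removed.

   The two claims follow from the recurrence
     [A_(d + 1, k) = t \sum_(l < k) A_(d, l) + \sum_(l >= k) A_(d, l)].
   Unimodality of each [A_(d, k)] is proved by induction using the symmetry
   [t ^ d A_(d, k) (1 / t) = A_(d, d - k) (t)].  For real-rootedness: if [Im z > 0],
   the complex numbers [A_(d, 0) (z)], ..., [A_(d, d) (z)] have strictly increasing
   arguments, spread over an angle of at most [arg z], so no nontrivial nonnegative
   combination of them vanishes. *)

(** * Refined Eulerian polynomials *)

(** For [k <= d], the coefficient of ['X^i] counts the permutations of [d + 1] letters with [i]
    descents and first letter [k + 1]; [l] encodes the second letter by its rank among the remaining
    ones. *)
Fixpoint eul (d k : nat) : {poly int} :=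
  if d is d'.+1 then
    \sum_(l < d'.+1) (if (l < k)%N then 'X else 1) * eul d' l
  else 1.

Lemma coef_ifX (b : bool) (p : {poly int}) i :
  ((if b then 'X else 1) * p)`_i =
  if b then (if i == 0%N then 0 else p`_i.-1) else p`_i.
Proof. by case: b; rewrite ?mul1r // coefXM. Qed.

Lemma coef_eulS d k i :
  (eul d.+1 k)`_i = \sum_(l < d.+1)
    (if (l < k)%N then (if i == 0%N then 0 else (eul d l)`_i.-1)
     else (eul d l)`_i).
Proof. by rewrite coef_sum; apply: eq_bigr => l _; rewrite coef_ifX. Qed.

Lemma eul_oversize d k i : (d < i)%N -> (eul d k)`_i = 0.
Proof.
elim: d k i => [|d IH] k [|i] // lt_di; first by rewrite coef1.
rewrite coef_eulS big1 //= => l _.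
by case: ifP => _; apply: IH => //; apply: ltnW.
Qed.

Lemma eul_ge0 d k i : 0 <= (eul d k)`_i.
Proof.
elim: d k i => [|d IH] k i; first by rewrite coef1; case: eqP.
by rewrite coef_eulS; apply: sumr_ge0 => l _; do 2?case: ifP.
Qed.

(** The two recurrences differ only in the summand [l = k], whose factor is 1 for [k] and ['X] for
    [k.+1]. *)
Lemma eul_subS d k : (k <= d)%N ->
  eul d.+1 k - eul d.+1 k.+1 = (1 - 'X) * eul d k.
Proof.
rewrite -ltnS => lt_kd; rewrite /= -sumrB (bigD1 (Ordinal lt_kd)) //=.
rewrite ltnn ltnSn big1 ?addr0 -?mulrBl // => l /negPf neq_lk.
rewrite -val_eqE /= in neq_lk.
by rewrite ltnS [(l <= k)%N]leq_eqVlt neq_lk subrr.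
Qed.

Lemma eul_last d : eul d.+1 d.+1 = 'X * eul d.+1 0.
Proof.
by rewrite /= mulr_sumr; apply: eq_bigr => l _; rewrite ltn_ord mul1r.
Qed.

(** Reversing the summation index exchanges the two branches of the recurrence. *)
Lemma eul_sym d k l i j : (k + l = d)%N -> (i + j = d)%N ->
  (eul d k)`_i = (eul d l)`_j.
Proof.
elim: d k l i j => [|d IH] k l i j.
  by case: k l i j => [|?] [|?] [|?] [|?].
move=> kl ij; rewrite !coef_eulS [RHS](reindex_inj rev_ord_inj) /=.
apply: eq_bigr => m _; have lt_md := ltn_ord m.
case: ltnP => [lt_mk | le_km].
  have -> : (d.+1 - m.+1 < l)%N = false by lia.
  (* If [i = 0], then [j = d + 1] exceeds the degree and both sides vanish. *)
  case: eqP => [i0|/eqP i_gt0]; last by apply: IH; lia.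
  by rewrite eul_oversize //; lia.
have -> : (d.+1 - m.+1 < l)%N by lia.
case: eqP => [j0|/eqP j_gt0]; last by apply: IH; lia.
by rewrite eul_oversize //; lia.
Qed.

(** By symmetry this concerns constant coefficients; they come only from the summand [l = 0], which
    lacks the factor ['X] only when [k = 0]. *)
Lemma eul_top d k : (k <= d)%N -> (eul d k)`_d = (k == d)%:R.
Proof.
move=> le_kd; rewrite (@eul_sym d k (d - k) d 0) ?addn0 ?subnKC //.
have -> : (k == d) = (d - k == 0)%N by lia.
have: (d - k <= d)%N by lia.
move: (d - k)%N => {k le_kd} k le_kd.
elim: d k le_kd => [|d IH] k le_kd; first by rewrite coef1; case: k le_kd.
rewrite coef_eulS /=; case: k le_kd => [|k] le_kd.
  rewrite big_ord_recl /= IH // big1 ?addr0 // => l _.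
  by rewrite IH //= lift0 ltn_ord.
rewrite big1 // => l _; case: ifP => // /negbT; rewrite -leqNgt => lt_kl.
have := ltn_ord l; rewrite ltnS => lt_ld.
by rewrite IH //; case: (l : nat) lt_kl.
Qed.

(** Raising the index by one subtracts a coefficient of [(1 - 'X) * eul d k], nonnegative below the
    middle. Monotonicity is a premise so that the induction for [eul_incr] can call this lemma. *)
Lemma eul_decr d : (forall k i, (k <= d)%N -> (i.+1.*2 <= d)%N ->
    (eul d k)`_i <= (eul d k)`_i.+1) ->
  forall k l i, (k <= l)%N -> (l <= d.+1)%N -> (i.*2 <= d)%N ->
    (eul d.+1 l)`_i <= (eul d.+1 k)`_i.
Proof.
move=> mono k l i le_kl; rewrite -(subnKC le_kl).
elim: (l - k)%N => [|m IH] le_l le_i; first by rewrite addn0.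
rewrite addnS; apply: le_trans (IH _ le_i); last by lia.
rewrite -subr_ge0 -coefB eul_subS; last by lia.
rewrite mulrBl mul1r coefB coefXM.
case: i le_i {IH} => [|i] le_i /=; first by rewrite subr0 eul_ge0.
by rewrite subr_ge0 mono //; lia.
Qed.

Lemma eul_incr d k i : (k <= d)%N -> (i.+1.*2 <= d)%N ->
  (eul d k)`_i <= (eul d k)`_i.+1.
Proof.
elim/ltn_ind: d k i => -[|d] // IH k i le_k le_i.
have incr_shift l : (l <= d)%N ->
    (if i == 0%N then 0 else (eul d l)`_i.-1) <= (eul d l)`_i.
  move=> le_l; case: i le_i => [|i] le_i /=; first exact: eul_ge0.
  by apply: IH => //; lia.
rewrite -subr_ge0 !coef_eulS /= -sumrB.
have [le_id | lt_di] := leqP i.+1.*2 d.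
  apply: sumr_ge0 => l _; have := ltn_ord l; rewrite ltnS => le_ld.
  by case: ifP => _; rewrite subr_ge0 ?incr_shift ?IH.
(* The step up to the centre: single differences [delta l] may be negative here. But they are
   antisymmetric under [l -> d - l] and nonnegative in the upper half, so they sum to 0 and every
   tail sum over [l >= k] is nonnegative. *)
have d_odd : (d = i.*2.+1)%N by lia.
pose delta (l : 'I_d.+1) : int := (eul d l)`_i.+1 - (eul d l)`_i.
have delta_anti (l : 'I_d.+1) : delta (rev_ord l) = - delta l.
  have := ltn_ord l; rewrite ltnS => le_ld.
  rewrite /delta opprB /=; congr (_ - _); apply: eul_sym; lia.
have delta_ge0 (l : 'I_d.+1) : (d < l.*2)%N -> 0 <= delta l.
  have := ltn_ord l; rewrite ltnS => le_ld lt_dl.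
  (* By symmetry [delta l] compares the [i]-th coefficients for the indices [d - l <= l]. *)
  rewrite /delta subr_ge0 (@eul_sym d l (d - l) i.+1 i); [|lia|lia].
  move: (nat_of_ord l) le_ld lt_dl => {}l le_ld lt_dl.
  rewrite d_odd; apply: eul_decr; try lia.
  by move=> k' i' *; apply: IH => //; lia.
have delta_le0 (l : 'I_d.+1) : (l.*2 <= d)%N -> delta l <= 0.
  have := ltn_ord l; rewrite ltnS => le_ld lt_dl.
  by rewrite -[delta l]opprK -delta_anti oppr_le0 delta_ge0 //=; lia.
have delta_sum : \sum_l delta l = 0.
  suff: \sum_l delta l = - \sum_l delta l by lia.
  rewrite -sumrN [LHS](reindex_inj rev_ord_inj).
  by apply: eq_bigr.
have tail_ge0 : 0 <= \sum_(l < d.+1 | ~~ (l < k)%N) delta l.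
  have [lt_dk | le_kd] := ltnP d k.*2.
    by apply: sumr_ge0 => l; rewrite -leqNgt => ?; apply: delta_ge0; lia.
  move: delta_sum; rewrite (bigID (fun l : 'I_d.+1 => (l < k)%N)) /= => /eqP.
  rewrite addrC addr_eq0 => /eqP ->; rewrite -sumrN.
  by apply: sumr_ge0 => l ?; rewrite oppr_ge0 delta_le0 //; lia.
rewrite (bigID (fun l : 'I_d.+1 => (l < k)%N)) /=.
apply: addr_ge0.
  apply: sumr_ge0 => l lt_lk; rewrite lt_lk subr_ge0 incr_shift //.
  by rewrite -ltnS.
by move: tail_ge0; congr (0 <= _); apply: eq_bigr => l /negPf ->.
Qed.

Lemma eul_decr_coef d k i : (k <= d)%N -> (d <= i.*2)%N -> (i < d)%N ->
  (eul d k)`_i.+1 <= (eul d k)`_i.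
Proof.
move=> le_kd le_di lt_id.
rewrite (@eul_sym d k (d - k) i.+1 (d - i.+1)); [|lia|lia].
rewrite (@eul_sym d k (d - k) i (d - i.+1).+1); [|lia|lia].
by apply: eul_incr; lia.
Qed.

(** * Backward differences and lattice point counts of half-open cubes *)

Definition bdiff (G : zmodType) (g : nat -> G) (n : nat) : G :=
  if n is n'.+1 then g n - g n' else g 0%N.

Lemma eq_iter_bdiff (G : zmodType) (g h : nat -> G) r :
  g =1 h -> iter r (@bdiff G) g =1 iter r (@bdiff G) h.
Proof. by move=> gh; elim: r => //= r IH [|n] /=; rewrite !IH. Qed.

(** With the value 0 before index 0, [bdiff] multiplies the generating series of [g] by [1 - t]. *)
Lemma sum_coef_bdiff (G : zmodType) (g : nat -> G) r i :
  \sum_(j < i.+1) g (i - j)%N *~ ((1 - 'X) ^+ r : {poly int})`_j =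
  iter r (@bdiff G) g i.
Proof.
elim: r i => [|r IH] i.
  rewrite big_ord_recl subn0 expr0 coef1 mulr1z big1 ?addr0 // => j _.
  by rewrite coef1 mulr0z.
rewrite iterS exprS.
under eq_bigr => j _ do rewrite mulrBl mul1r coefB coefXM mulrzBr.
rewrite sumrB IH big_ord_recl /= mulr0z add0r.
case: i => [|i] /=; first by rewrite big_ord0 subr0.
by congr (_ - _); rewrite -IH; apply: eq_bigr => j _.
Qed.

Lemma iter_bdiff_sum (G : zmodType) (I : finType) (c : I -> G)
    (g : I -> nat -> int) r i :
  iter r (@bdiff G) (fun n => \sum_k c k *~ g k n) i =
  \sum_k c k *~ iter r (@bdiff int) (g k) i.
Proof.
elim: r i => // r IH [|i] /=; rewrite !IH //.
by rewrite -sumrB; apply: eq_bigr => k _; rewrite mulrzBr.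
Qed.

(** The number of lattice points in the [n]-th dilate of the unit [d]-cube with [k] pairwise
    non-opposite facets removed, for [k <= d]. *)
Definition cube_count d k (n : nat) : int := (n ^ k * n.+1 ^ (d - k))%N.

(** The discrepancy [W k i] is independent of [k], as [(n + 1) - n = 1] gives the counts the
    difference rule [eul_subS]. Going from index 0 to index [d.+1] shifts both sides by one, so [W]
    vanishes by induction on [i]. *)
Lemma bdiff_cube_count d k i : (k <= d)%N ->
  iter d.+1 (@bdiff int) (cube_count d k) i = (eul d k)`_i.
Proof.
elim: d k i => [|d IH] k i le_kd.
  case: k le_kd => // _; case: i => [|[|i]];
  by rewrite coef1 /bdiff /cube_count ?subrr.
pose W k i := iter d.+2 (@bdiff int) (cube_count d.+1 k) i - (eul d.+1 k)`_i.
have WS k' i' : (k' <= d)%N -> W k'.+1 i' = W k' i'.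
  move=> le_k'd.
  have subE r j : iter r (@bdiff int) (cube_count d.+1 k') j -
      iter r (@bdiff int) (cube_count d.+1 k'.+1) j =
      iter r (@bdiff int) (cube_count d k') j.
    elim: r j => [|r IHr] j.
      rewrite /= /cube_count subSS subSn // !expnS !PoszM [Posz j.+1]intS.
      by ring.
    by case: j => [|j] /=; rewrite -!IHr //; ring.
  have diffE : iter d.+2 (@bdiff int) (cube_count d k') i' =
      ((1 - 'X) * eul d k')`_i'.
    rewrite iterS mulrBl mul1r coefB coefXM.
    by case: i' => [|i']; rewrite /bdiff !IH ?subr0.
  move: (subE d.+2 i'); rewrite diffE -eul_subS // coefB /W.
  do 2!move: (iter _ _ _ _) => ?; move: (_)`_i' (_)`_i' => ? ?; lia.
have W0 k' i' : (k' <= d.+1)%N -> W k' i' = W 0%N i'.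
  by elim: k' => // k' IHk le_k'd; rewrite WS // IHk // ltnW.
have shiftE r i' : iter r (@bdiff int) (cube_count d.+1 d.+1) i' =
    if i' is i''.+1 then iter r (@bdiff int) (cube_count d.+1 0) i'' else 0.
  elim: r i' => [|r IHr] [|i'] //=.
      by rewrite /cube_count exp0n.
    by rewrite /cube_count subnn !expn0 muln1 mul1n subn0.
  by case: i' => [|i'] /=; rewrite !IHr ?subr0.
suff W00 i' : W 0%N i' = 0.
  by apply/eqP; rewrite -subr_eq0; apply/eqP; rewrite -/(W k i) W0.
elim: i' => [|i' IHi]; rewrite -(W0 d.+1) // /W shiftE eul_last coefXM /=.
  by rewrite subr0.
exact: IHi.
Qed.

(** * Real roots of nonnegative combinations *)

(** The imaginary part of the conjugate of [u] times [v]: positive when [v] lies counterclockwise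
    from [u] by an angle strictly between 0 and pi. *)
Definition cross (R : realType) (u v : complex R) : R :=
  complex.Re u * complex.Im v - complex.Im u * complex.Re v.

Section Cross.
Variable R : realType.
Local Notation C := (complex R).
Implicit Types u v w z : C.

Lemma ReD u v : complex.Re (u + v) = complex.Re u + complex.Re v.
Proof. by case: u v => ? ? []. Qed.

Lemma ImD u v : complex.Im (u + v) = complex.Im u + complex.Im v.
Proof. by case: u v => ? ? []. Qed.

Lemma crossvv u : cross u u = 0.
Proof. by rewrite /cross mulrC subrr. Qed.

Lemma crossDl u v w : cross (u + v) w = cross u w + cross v w.
Proof. by rewrite /cross ReD ImD; ring. Qed.

Lemma crossDr u v w : cross w (u + v) = cross w u + cross w v.
Proof. by rewrite /cross ReD ImD; ring. Qed.

Lemma cross0l u : cross 0 u = 0.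
Proof. by rewrite /cross /= !mul0r subrr. Qed.

Lemma cross0r u : cross u 0 = 0.
Proof. by rewrite /cross /= !mulr0 subrr. Qed.

Lemma cross_suml (I : finType) (P : pred I) (f : I -> C) u :
  cross (\sum_(i | P i) f i) u = \sum_(i | P i) cross (f i) u.
Proof.
by elim/big_rec2: _ => [|i x v _ <-]; rewrite ?cross0l ?crossDl.
Qed.

Lemma cross_sumr (I : finType) (P : pred I) (f : I -> C) u :
  cross u (\sum_(i | P i) f i) = \sum_(i | P i) cross u (f i).
Proof.
by elim/big_rec2: _ => [|i x v _ <-]; rewrite ?cross0r ?crossDr.
Qed.

Definition sqabs z : R := complex.Re z ^+ 2 + complex.Im z ^+ 2.

Lemma sqabs_ge0 z : 0 <= sqabs z.
Proof. by rewrite addr_ge0 ?sqr_ge0. Qed.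

Lemma sqabs_gt0 z : z != 0 -> 0 < sqabs z.
Proof.
case: z => a b z_neq0; rewrite lt_neqAle sqabs_ge0 andbT eq_sym /sqabs /=.
apply: contra z_neq0; rewrite paddr_eq0 ?sqr_ge0 // !sqrf_eq0.
by case/andP => /eqP-> /eqP->.
Qed.

Lemma cross_mul z u v : cross (z * u) (z * v) = sqabs z * cross u v.
Proof. by case: z u v => a b [c e] [f g]; rewrite /cross /sqabs /=; ring. Qed.

Lemma crossvz z u : cross u (z * u) = complex.Im z * sqabs u.
Proof. by case: z u => a b [c e]; rewrite /cross /sqabs /=; ring. Qed.

Lemma cross_swap_mul z u v : cross (z * u) v + cross v (z * u) = 0.
Proof. by rewrite /cross; ring. Qed.

(* The points [a 0], ..., [a d] lie in this angular order, and the angle from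
   [a 0] to [a d] is at most the argument of [z]. *)
Definition fan z (d : nat) (a : nat -> C) : Prop :=
  [/\ forall k, (k <= d)%N -> a k != 0,
      forall k l, (k < l <= d)%N -> 0 < cross (a k) (a l) &
      forall k l, (k <= l <= d)%N -> 0 <= cross (a l) (z * a k)].

Lemma fan_step z d (a : nat -> C) : 0 < complex.Im z -> fan z d a ->
  fan z d.+1 (fun k => \sum_(l < d.+1) (if (l < k)%N then z else 1) * a l).
Proof.
move=> z_gt0 [a_neq0 a_lt a_z].
set b := fun k => _.
have a_le k l : (k <= l <= d)%N -> 0 <= cross (a k) (a l).
  case/andP; rewrite leq_eqVlt => /orP[/eqP->|lt_kl le_ld].
    by rewrite crossvv.
  by apply/ltW/a_lt/andP.
(* Split the indices at [k] and [m]. Then [b k] and [b m] share [z * P k + U m] and differ only in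
   [M k m] against [z * M k m], so every claim reduces to cross products between blocks. *)
pose P k := \sum_(l < d.+1 | (l < k)%N) a l.
pose M k m := \sum_(l < d.+1 | (k <= l < m)%N) a l.
pose U m := \sum_(l < d.+1 | (m <= l)%N) a l.
have bE k m : (k <= m)%N -> b k = z * P k + U m + M k m.
  move=> le_km; rewrite /b (bigID (fun l : 'I_d.+1 => (l < k)%N)) /=.
  rewrite -addrA; congr (_ + _).
    by rewrite mulr_sumr; apply: eq_bigr => l ->.
  rewrite (bigID (fun l : 'I_d.+1 => (m <= l)%N)) /=; congr (_ + _).
    apply: eq_big => [l|l /andP[/negPf-> _]]; last by rewrite mul1r.
    by rewrite -leqNgt; lia.
  apply: eq_big => [l|l /andP[/negPf-> _]]; last by rewrite mul1r.
  by rewrite -leqNgt; lia.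
have bE' k m : (k <= m)%N -> b m = z * P k + U m + z * M k m.
  move=> le_km; rewrite /b (bigID (fun l : 'I_d.+1 => (l < k)%N)) /=.
  rewrite -addrA; congr (_ + _).
    rewrite mulr_sumr; apply: eq_bigr => l lt_lk.
    by rewrite (leq_trans lt_lk le_km).
  rewrite (bigID (fun l : 'I_d.+1 => (m <= l)%N)) /=; congr (_ + _).
    apply: eq_big => [l|l /andP[_]]; first by rewrite -leqNgt; lia.
    by rewrite leqNgt => /negPf->; rewrite mul1r.
  rewrite mulr_sumr; apply: eq_big => [l|l /andP[_]].
    by rewrite -leqNgt; lia.
  by rewrite -ltnNge => ->.
have ordle (l : 'I_d.+1) : (l <= d)%N by rewrite -ltnS.
have PM k m : 0 <= cross (P k) (M k m).
  rewrite cross_suml sumr_ge0 // => l lt_l; rewrite cross_sumr sumr_ge0 // => n.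
  by move=> /andP[le_n _]; apply: a_le; rewrite ordle andbT; lia.
have MU k m : 0 <= cross (M k m) (U m).
  rewrite cross_suml sumr_ge0 // => l lt_l; rewrite cross_sumr sumr_ge0 // => n.
  by move=> le_n; apply: a_le; rewrite ordle andbT; lia.
have MzP k m : 0 <= cross (M k m) (z * P k).
  rewrite cross_suml sumr_ge0 // => l lt_l.
  rewrite mulr_sumr cross_sumr sumr_ge0 // => n lt_n.
  by apply: a_z; rewrite ordle andbT; lia.
have UzM k m : 0 <= cross (U m) (z * M k m).
  rewrite cross_suml sumr_ge0 // => l lt_l.
  rewrite mulr_sumr cross_sumr sumr_ge0 // => n lt_n.
  by apply: a_z; rewrite ordle andbT; lia.
have M_neq0 k m : (k < m <= d.+1)%N -> M k m != 0.
  case/andP=> lt_km le_m; have lt_kd : (k < d.+1)%N by lia.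
  rewrite /M (bigD1 (Ordinal lt_kd)) /=; last by rewrite leqnn.
  have [->|lt_k1m] := eqVneq m k.+1.
    rewrite big_pred0 ?addr0 ?a_neq0 // => l.
    by rewrite -val_eqE /=; lia.
  (* Against [a k], the term [a k.+1] contributes positively and no later term negatively. *)
  apply/eqP => /(congr1 (cross (a k))); rewrite cross0r crossDr crossvv add0r.
  apply/eqP; rewrite gt_eqF // cross_sumr.
  have lt_k1d : (k.+1 < d.+1)%N by lia.
  rewrite (bigD1 (Ordinal lt_k1d)) /=; last by rewrite -val_eqE /=; lia.
  rewrite ltr_wpDr ?a_lt ?ltnSn //=.
  apply: sumr_ge0 => l /andP[/andP[/andP[le_kl _] _] _].
  by apply: a_le; rewrite le_kl ordle.
have b_lt k m : (k < m <= d.+1)%N -> 0 < cross (b k) (b m).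
  move=> /[dup] /M_neq0 M0 /andP[lt_km le_m].
  rewrite (bE k m) ?(bE' k m) 1?ltnW // !(crossDl, crossDr) !crossvv.
  rewrite !cross_mul.
  have := cross_swap_mul z (P k) (U m).
  have := mulr_ge0 (sqabs_ge0 z) (PM k m).
  have := PM k m; have := MU k m; have := MzP k m; have := UzM k m.
  rewrite crossvz.
  have := mulr_gt0 z_gt0 (sqabs_gt0 M0).
  by lra.
split => //.
- case=> [|k] le_k; apply/eqP => b0.
    by have := b_lt 0%N d.+1 (leqnn d.+1); rewrite b0 cross0l ltxx.
  by have := b_lt 0%N k.+1 le_k; rewrite b0 cross0r ltxx.
- move=> k m /andP[le_km le_m].
  rewrite (bE k m) ?(bE' k m) //.
  move WE: (z * P k + U m) => W.
  rewrite mulrDr !crossDl !crossDr crossvz crossvv cross_mul.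
  have := mulr_ge0 (ltW z_gt0) (sqabs_ge0 W).
  have W1 : 0 <= cross W (z * M k m).
    rewrite -WE crossDl cross_mul addr_ge0 //.
    by rewrite mulr_ge0 ?sqabs_ge0.
  have W2 : 0 <= sqabs z * cross (M k m) W.
    by rewrite mulr_ge0 ?sqabs_ge0 // -WE crossDr addr_ge0.
  by move: W1 W2; lra.
Qed.

Lemma eul_fan z d : 0 < complex.Im z ->
  fan z d (fun k => (map_poly intr (eul d k)).[z]).
Proof.
move=> z_gt0; elim: d => [|d IH].
  split=> [k _|k l|k l _]; last 2 first.
  - by case: l => [|l]; rewrite ?ltn0 ?andbF.
  - by rewrite /= rmorph1 hornerC crossvz mulr_ge0 ?sqabs_ge0 // ltW.
  by rewrite /= rmorph1 hornerC oner_neq0.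
have := fan_step z_gt0 IH; congr fan; apply/funext => k /=.
rewrite /= rmorph_sum horner_sum; apply: eq_bigr => l _.
rewrite rmorphM hornerM /=; congr (_ * _).
by case: ifP => _; rewrite ?map_polyX ?hornerX ?rmorph1 ?hornerC.
Qed.

(** All [a k] with [k > 0] lie strictly on one side of the line through [a 0], so the cross product
    with [a 0] detects any nonzero [c k] with [k > 0]; failing that, the sum is [c 0] times the
    nonzero [a 0]. *)
Lemma eul_comb_neq0 z d (c : nat -> R) : 0 < complex.Im z ->
  (forall k, 0 <= c k) -> (exists2 k, (k <= d)%N & c k != 0) ->
  \sum_(k < d.+1) real_complex R (c k) * (map_poly intr (eul d k)).[z] != 0.
Proof.
move=> z_gt0 c_ge0 [m le_md cm_neq0].
pose a k := (map_poly intr (eul d k)).[z].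
have [a_neq0 a_lt _] : fan z d a := eul_fan d z_gt0.
rewrite -[X in X != 0]/(\sum_(k < d.+1) real_complex R (c k) * a k).
have crossZ (r : R) u v : cross u (real_complex R r * v) = r * cross u v.
  by case: u v => ? ? [? ?]; rewrite /cross /=; ring.
have pos k : (k <= d)%N -> 0 <= cross (a 0%N) (a k).
  by case: k => [|k] le_kd; [rewrite crossvv | rewrite ltW ?a_lt].
have [m0|m_gt0] := posnP m; last first.
  apply/eqP => /(congr1 (cross (a 0%N))); rewrite cross0r cross_sumr.
  apply/eqP; rewrite gt_eqF // (bigD1 (Ordinal (le_md : (m < d.+1)%N))) //=.
  rewrite ltr_wpDr //.
    by apply: sumr_ge0 => k _; rewrite crossZ mulr_ge0 ?pos // -ltnS.
  by rewrite crossZ mulr_gt0 ?a_lt ?m_gt0 // lt_neqAle eq_sym cm_neq0 c_ge0.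
have [[k k_gt0 le_kd]|c_eq0] :=
    pselect (exists2 k, (0 < k <= d)%N & c k != 0).
  apply/eqP => /(congr1 (cross (a 0%N))); rewrite cross0r cross_sumr.
  case/andP: k_gt0 => k_gt0 lt_kd.
  apply/eqP; rewrite gt_eqF // (bigD1 (Ordinal (lt_kd : (k < d.+1)%N))) //=.
  rewrite ltr_wpDr //.
    by apply: sumr_ge0 => l _; rewrite crossZ mulr_ge0 ?pos // -ltnS.
  by rewrite crossZ mulr_gt0 ?a_lt ?k_gt0 // lt_neqAle eq_sym le_kd c_ge0.
rewrite big_ord_recl big1 ?addr0 => [|l _].
  rewrite mulf_neq0 ?a_neq0 //=.
  by apply: contra cm_neq0; rewrite m0 => /eqP/(congr1 (@complex.Re R)) /= ->.
have [->|cl] := eqVneq (c (lift ord0 l)) 0; first by rewrite mul0r.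
by case: c_eq0; exists (lift ord0 l) => //; rewrite lift0 /=.
Qed.

Lemma eul_comb_real_rooted d (c : nat -> R) : (forall k, 0 <= c k) ->
  real_rooted (\sum_(k < d.+1) c k *: map_poly intr (eul d k)).
Proof.
move=> c_ge0; set p := \sum_(k < _) _.
have [[k le_kd ck]|c_eq0] := pselect (exists2 k, (k <= d)%N & c k != 0).
  right; have im_le0 z : root (map_poly (real_complex R) p) z ->
      ~~ (0 < complex.Im z).
    apply: contraL => z_gt0; rewrite /root.
    rewrite rmorph_sum horner_sum.
    under eq_bigr => l _ do
      rewrite /= map_polyZ hornerZ -map_poly_comp (eq_map_poly (rmorph_int _)).
    by apply: eul_comb_neq0 => //; exists k.
  move=> z rz; apply/eqP; have := im_le0 _ rz.
  rewrite -leNgt le_eqVlt => /orP[//|z_lt0].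
  (* The coefficients are real, so conjugation moves a root from the lower to the upper
     half-plane. *)
  suff: root (map_poly (real_complex R) p) (conjc z).
    by move/im_le0; case: (z) z_lt0 => x y /=; rewrite oppr_gt0 => ->.
  have -> : map_poly (real_complex R) p =
            map_poly conjc (map_poly (real_complex R) p).
    by rewrite -map_poly_comp; apply: eq_map_poly => x /=; rewrite oppr0.
  by rewrite fmorph_root.
left; apply: big1 => k _.
have [->|ck] := eqVneq (c k) 0; first by rewrite scale0r.
by case: c_eq0; exists k => //; rewrite -ltnS.
Qed.
End Cross.

(** * Difference operators *)

Section Operators.
Variables (V : zmodType) (G : zmodType).
Implicit Types (F : seq V -> G) (s t : seq V) (os : seq (V * (int * int))).

(** The entry [(v, (a, b))] stands for the operator [a E_v + b], where [E_v] adds the generator [v];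
    a list stands for the composite. *)
Fixpoint app os F s : G :=
  if os is (v, (a, b)) :: os' then app os' F (v :: s) *~ a + app os' F s *~ b
  else F s.

Definition perm_invariant F := forall s t, perm_eq s t -> F s = F t.

Lemma app_perm_invariant os F : perm_invariant F -> perm_invariant (app os F).
Proof.
move=> F_perm; elim: os => [|[v [a b]] os IH] //= s t st.
by rewrite (IH _ _ st) (IH (v :: s) (v :: t)) // perm_cons.
Qed.

Lemma app_cat os os' F s : app (os ++ os') F s = app os (app os' F) s.
Proof. by elim: os s => [|[v [a b]] os IH] //= s; rewrite !IH. Qed.

Lemma eq_app os F F' : F =1 F' -> app os F =1 app os F'.
Proof. by move=> FF'; elim: os => [|[v [a b]] os IH] //= s; rewrite !IH. Qed.

Lemma app_eq0 os F : (forall s, F s = 0) -> forall s, app os F s = 0.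
Proof.
by move=> F0; elim: os => [|[v [a b]] os IH] //= s; rewrite !IH !mul0rz addr0.
Qed.

Lemma app_swap o o' os F s : perm_invariant F ->
  app (o :: o' :: os) F s = app (o' :: o :: os) F s.
Proof.
case: o o' => [v [a b]] [w [a' b']] F_perm /=.
rewrite (app_perm_invariant os F_perm (s := [:: w, v & s]) (t := [:: v, w & s]));
  last by rewrite -cat1s -[_ :: s]cat1s perm_catCA.
by rewrite !mulrzDl -!mulrzA addrACA ![_ * a]mulrC ![_ * b]mulrC.
Qed.

Lemma app_front o os os' F s : perm_invariant F ->
  app (os ++ o :: os') F s = app (o :: os ++ os') F s.
Proof.
move=> F_perm; elim: os s => // -[v [a b]] os IH s.
by rewrite app_swap //= !IH.
Qed.

Lemma app_perm os os' F s : perm_invariant F -> perm_eq os os' ->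
  app os F s = app os' F s.
Proof.
move=> F_perm.
elim: os os' s => [|[v [a b]] os IH] os' s.
  by rewrite perm_sym => /perm_nilP->.
move=> os_os'; have : (v, (a, b)) \in os'.
  by rewrite -(perm_mem os_os') mem_head.
move=> o_in; case/splitPr: o_in os_os' => os1 os2 os_os'.
have {}os_os' : perm_eq os (os1 ++ os2).
  by rewrite -(perm_cons (v, (a, b))) (perm_trans os_os') // -cat1s perm_catCA.
by rewrite app_front //= !(IH (os1 ++ os2)).
Qed.

Lemma app_catC os os' F s : perm_invariant F ->
  app (os ++ os') F s = app (os' ++ os) F s.
Proof. by move=> F_perm; apply: app_perm; rewrite // perm_catC. Qed.

Lemma appD v a b a' b' os F s :
  app ((v, (a + a', b + b')) :: os) F s =
  app ((v, (a, b)) :: os) F s + app ((v, (a', b')) :: os) F s.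
Proof. by rewrite /= !mulrzDr addrACA. Qed.

Lemma appM v a b c os F s :
  app ((v, (a * c, b * c)) :: os) F s = app ((v, (a, b)) :: os) F s *~ c.
Proof. by rewrite /= !mulrzA mulrzDl. Qed.

Lemma app_cons v a b os F s :
  app ((v, (a, b)) :: os) F s = app os F (v :: s) *~ a + app os F s *~ b.
Proof. by []. Qed.

End Operators.

Arguments app : simpl never.

(* With [F s] the value of a valuation on the zonotope generated by [s], [dop v]
   is the difference operator [D_v] of adding the generator [v]; as [D_v] squares
   to zero, [eop n v] adds [n] copies of [v], and [bop v], which is [D_v - 1],
   yields the open unit cell. *)
Definition dop (V : zmodType) (v : V) : V * (int * int) := (v, (1, -1)).
Definition bop (V : zmodType) (v : V) : V * (int * int) := (v, (1, -2)).
Definition ndop (V : zmodType) (n : nat) (v : V) : V * (int * int) :=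
  (v, (n%:Z, - n%:Z)).
Definition eop (V : zmodType) (n : nat) (v : V) : V * (int * int) :=
  (v, (n%:Z, 1 - n%:Z)).

Lemma app_eop (V G : zmodType) n (v : V) os (F : seq V -> G) s :
  app (eop n v :: os) F s = app os F s + app (ndop n v :: os) F s.
Proof. by rewrite !app_cons mulrzBr mulr1z mulrNz addrCA. Qed.

Lemma app_ndop (V G : zmodType) n (v : V) os (F : seq V -> G) s :
  app (ndop n v :: os) F s = app os F s *~ n + app (bop v :: os) F s *~ n.
Proof.
have -> : ndop n v = (v, (0 + 1 * n%:Z, n%:Z + (-2) * n%:Z)).
  by congr (_, (_, _)); lia.
by rewrite appD appM app_cons mulr0z add0r.
Qed.

Lemma app_eop_bop (V G : zmodType) n (v : V) os (F : seq V -> G) s :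
  app (eop n v :: os) F s = app os F s *~ n.+1 + app (bop v :: os) F s *~ n.
Proof. by rewrite app_eop app_ndop addrA intS mulrzDr mulr1z. Qed.

(** * Products of difference operators over dependent vectors *)

Section Dependent.
Variables (d : nat) (G : zmodType).
Local Notation V := 'rV[int]_d.

(** The middle clause reads [D_v E_w = D_v E_(v + w)], with [E_w] the operator adding [w]. *)
Definition zonal (F : seq V -> G) : Prop :=
  [/\ perm_invariant F,
      forall v w s, F (v :: w :: s) - F (w :: s) =
                    F (v :: (v + w) :: s) - F ((v + w) :: s) &
      forall s, F (0 :: s) = F s].

Variable F : seq V -> G.
Hypothesis F_zonal : zonal F.

(** Since [E_w = 1 + D_w], this is the middle clause of [zonal] with [D_v] cancelled. *)
Lemma app_dop_shear os v w s :
  app (os ++ [:: dop v; dop w]) F s = app (os ++ [:: dop v; dop (v + w)]) F s.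
Proof.
case: F_zonal => F_perm F_shear _; rewrite !app_cat; apply: eq_app => {}s.
rewrite !app_cons !mulr1z !mulrN1z /app.
have swap a b : F [:: a, b & s] = F [:: b, a & s].
  by apply: F_perm; rewrite -cat1s -[_ :: s]cat1s perm_catCA.
have := F_shear v w s; rewrite ![F [:: v, _ & _]]swap.
by move=> H; rewrite !opprD [LHS]addrACA [RHS]addrACA H.
Qed.

Lemma app_dop0 os s : app (os ++ [:: dop 0]) F s = 0.
Proof.
case: F_zonal => _ _ F0; rewrite app_cat; apply: app_eq0 => {}s.
by rewrite app_cons /app F0 mulr1z mulrN1z subrr.
Qed.

(* Euclid's algorithm on the coefficients of the relation: shearing one vector
   by another reduces them until a single multiple of one vector vanishes. *)
Lemma app_dop_dependent (L : seq (int * V)) s :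
  \sum_(p <- L) p.1 *: p.2 = 0 -> has (fun p => p.1 != 0) L ->
  app [seq dop p.2 | p <- L] F s = 0.
Proof.
have F_perm : perm_invariant F by case: F_zonal.
have [N] := ubnP (\sum_(p <- L) `|p.1|)%N; elim: N L s => // N IH L s.
move=> ltN sum0 /hasP[[a v] avL /= a_neq0].
move: (perm_to_rem avL) ltN sum0; move: (rem _ _) => {avL} L' permL.
rewrite !(perm_big _ permL) !big_cons /= => ltN sum0.
rewrite (app_perm _ F_perm (perm_map _ permL)) {L permL}.
have [/hasP[[b w] bwL /= b_neq0]|/hasPn L'0] :=
    boolP (has (fun p : int * V => p.1 != 0) L'); last first.
  (* When [a] is the only nonzero coefficient, the relation forces [v = 0], and [D_0 = 0]. *)
  have v0 : v = 0.
    have {sum0} av0 : a *: v = 0.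
      move: sum0; rewrite big_seq big1 ?addr0 // => p /L'0.
      by rewrite negbK => /eqP->; rewrite scale0r.
    apply/rowP => j; move/rowP/(_ j)/eqP: av0; rewrite !mxE mulf_eq0.
    by rewrite (negPf a_neq0) /= => /eqP.
  by rewrite map_cons -cat1s app_catC // v0 app_dop0.
move: (perm_to_rem bwL) ltN sum0; move: (rem _ _) => {bwL} L permL'.
rewrite !(perm_big _ permL') !big_cons /= => ltN sum0.
have shear x y (M : seq (int * V)) t :
    app [:: dop x, dop y & [seq dop p.2 | p <- M]] F t =
    app [:: dop x, dop (x + y) & [seq dop p.2 | p <- M]] F t.
  rewrite -[LHS](app_catC _ [:: _; _]) // app_dop_shear.
  by rewrite (app_catC _ [:: _; _]).
have unshear x y (M : seq (int * V)) t :
    app [:: dop x, dop y & [seq dop p.2 | p <- M]] F t =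
    app [:: dop x, dop (y - x) & [seq dop p.2 | p <- M]] F t.
  by rewrite [RHS]shear addrC subrK.
have -> : app [seq dop p.2 | p <- (a, v) :: L'] F s =
          app [:: dop v, dop w & [seq dop p.2 | p <- L]] F s.
  by apply: app_perm; rewrite // perm_cons (perm_map _ permL').
wlog le_ba : a b v w a_neq0 b_neq0 ltN sum0 {permL' L'} /
    (`|b| <= `|a|)%N.
  move=> wl; have [|/ltnW le_ab] := leqP `|b| `|a|; first exact: wl.
  rewrite app_swap //; apply: (wl b a w v) => //; first by rewrite addnCA.
  by rewrite addrCA.
have step c y : (`|c| < `|a|)%N -> a *: v + b *: w = c *: v + b *: y ->
    app [:: dop v, dop y & [seq dop p.2 | p <- L]] F s = 0.
  move=> lt_ca eq_av; apply: (IH [:: (c, v), (b, y) & L]).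
  - by rewrite !big_cons /=; lia.
  - by rewrite !big_cons /= addrA -eq_av -addrA.
  - by rewrite /= b_neq0 orbT.
(* Rewriting [a v + b w] as [(a - b) v + b (v + w)] or as [(a + b) v + b (w - v)], according to the
   signs, shrinks the coefficient of [v] and keeps that of the other vector. *)
have [same|opposite] := boolP ((0 < a) == (0 < b)).
  rewrite shear; apply: (step (a - b)); first by lia.
  by rewrite scalerBl scalerDr addrA subrK.
rewrite unshear; apply: (step (a + b)); first by lia.
by rewrite scalerDl scalerBr -addrA [b *: v + _]addrC subrK.
Qed.

End Dependent.

(** * Expansions in the products [n ^ k (n + 1) ^ (r - k)] *)

Section Magic.
Variable G : zmodType.
Implicit Types (c : nat -> G) (f g : nat -> G).

Definition cube_expansion r c f : Prop :=
  forall n, f n = \sum_(k < r.+1) c k *~ cube_count r k n.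

(** A factor [n + 1] keeps the index [k]; a factor [n] raises it by one. *)
Lemma cube_expansionS r c1 c2 f g :
  cube_expansion r c1 f -> cube_expansion r c2 g ->
  cube_expansion r.+1
    (fun k => (if (k <= r)%N then c1 k else 0) + (if k is l.+1 then c2 l else 0))
    (fun n => f n *~ n.+1 + g n *~ n).
Proof.
move=> fE gE n; under eq_bigr do rewrite mulrzDl.
rewrite big_split /= fE gE; congr (_ + _).
  rewrite [RHS]big_ord_recr /= ltnn mul0rz addr0 mulrz_suml; apply: eq_bigr => k _.
  have le_kr : (k <= r)%N by rewrite -ltnS.
  by rewrite le_kr -mulrzA /cube_count subSn // expnS mulnCA PoszM mulrC.
rewrite [RHS]big_ord_recl /= mul0rz add0r mulrz_suml; apply: eq_bigr => k _.
by rewrite -mulrzA /cube_count subSS expnS -mulnA PoszM mulrC.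
Qed.

Lemma bdiff_cube_expansion r c f i : cube_expansion r c f ->
  iter r.+1 (@bdiff G) f i = \sum_(k < r.+1) c k *~ (eul r k)`_i.
Proof.
move=> fE; rewrite (eq_iter_bdiff _ fE) iter_bdiff_sum.
by apply: eq_bigr => k _; rewrite bdiff_cube_count // -ltnS.
Qed.

(** Among the [eul r k] only [eul r r] reaches degree [r], with coefficient 1. *)
Lemma bdiff_cube_expansion_top r c f : cube_expansion r c f ->
  iter r.+1 (@bdiff G) f r = c r.
Proof.
move/bdiff_cube_expansion->; rewrite big_ord_recr /= eul_top // eqxx mulr1z.
rewrite big1 ?add0r // => k _; have := ltn_ord k => lt_kr.
by rewrite eul_top ?(ltnW lt_kr) // ltn_eqF // mulr0z.
Qed.

(** Expand the product of the [(n + 1) + n B_v]; the last coefficient takes [B_v] from every factor.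
    In the induction [T] collects the [B_v] already taken. *)
Lemma app_eop_expansion (V : zmodType) (F : seq V -> G) (ws : seq V) T s :
  perm_invariant F ->
  exists c, cube_expansion (size ws) c
              (fun n => app (map (eop n) ws ++ T) F s) /\
            c (size ws) = app (map (@bop V) ws ++ T) F s.
Proof.
move=> F_perm; elim: ws T => [|v ws IH] T.
  exists (fun=> app T F s); split=> // n.
  by rewrite big_ord1 /cube_count mulr1z.
have [c1 [c1E _]] := IH T; have [c2 [c2E c2top]] := IH (bop v :: T).
eexists; split.
  move=> n; rewrite /= app_eop_bop.
  rewrite -[app (bop v :: _) F s](app_perm _ F_perm
    (os := map (eop n) ws ++ bop v :: T)).
    exact: cube_expansionS c1E c2E n.
  by rewrite -[bop v :: T]cat1s -[_ :: _ ++ _]cat1s perm_catCA.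
rewrite /= ltnn add0r c2top; apply: app_perm => //.
by rewrite -[bop v :: T]cat1s -[_ :: _ ++ _]cat1s perm_catCA.
Qed.
End Magic.

(** * Minkowski sums, cuts and zonotopes *)

Section Geometry.
Variables (R : realType) (d : nat).
Local Notation V := 'rV[R]_d.
Implicit Types (P Q K T : set V) (v w x y : V) (s : seq V).

Definition msum P Q : set V :=
  [set x | exists y z, [/\ P y, Q z & x = y + z]].

Lemma msumA : associative msum.
Proof.
move=> P Q K; apply/seteqP; split=> x /=.
  move=> [p [_ [Pp [q [k [Qq Kk ->]]] ->]]].
  by exists (p + q), k; split; rewrite ?addrA //; exists p, q.
move=> [_ [k [[p [q [Pp Qq ->]]] Kk ->]]].
by exists p, (q + k); split; rewrite ?addrA //; exists q, k.
Qed.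

Lemma msumC : commutative msum.
Proof.
by move=> P Q; apply/seteqP; split=> x [y [z [? ? ->]]];
  exists z, y; rewrite addrC.
Qed.

Lemma msum0 : left_id [set 0] msum.
Proof.
move=> P; apply/seteqP; split=> x; first by move=> [_ [z [-> ? ->]]]; rewrite add0r.
by move=> Px; exists 0, x; rewrite add0r.
Qed.

Lemma msum_translate x P Q : msum (translate x P) Q = translate x (msum P Q).
Proof.
apply/seteqP; split=> z.
  move=> [_ [q [[p Pp <-] Qq ->]]]; exists (p + q); last by rewrite addrAC.
  by exists p, q.
move=> [_ [p [q [Pp Qq ->]]] <-]; exists (p + x), q; split=> //.
  by exists p.
by rewrite addrAC.
Qed.

(** Any finite index type is allowed, so that pairs can index a Minkowski sum. *)
Definition hull (I : finType) (p : I -> V) : set V :=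
  [set x | exists a : I -> R,
     [/\ forall i, 0 <= a i, \sum_i a i = 1 & x = \sum_i a i *: p i]].

Lemma conv_hull_enum (I : finType) (p : I -> V) :
  hull p = conv_hull (fun k : 'I_#|I| => p (enum_val k)).
Proof.
apply/seteqP; split=> x [a [a_ge0 a1 ->]].
  exists (fun k => a (enum_val k)); split=> //.
    by rewrite -a1 [RHS](reindex _ (onW_bij _ (enum_val_bij I))).
  by rewrite [LHS](reindex _ (onW_bij _ (enum_val_bij I))).
exists (fun i => a (enum_rank i)); split=> //.
  by rewrite -a1 [RHS](reindex _ (onW_bij _ (enum_rank_bij I))).
rewrite [LHS](reindex _ (onW_bij _ (enum_rank_bij I))).
by apply: eq_bigr => i _; rewrite enum_rankK.
Qed.

Lemma hull_mem (I : finType) (p : I -> V) i : hull p (p i).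
Proof.
exists (fun j => (j == i)%:R); split=> [j||]; first by rewrite ler0n.
  by rewrite (bigD1 i) //= eqxx big1 ?addr0 // => j /negPf->.
rewrite (bigD1 i) //= eqxx scale1r big1 ?addr0 // => j /negPf->.
by rewrite scale0r.
Qed.

(** Some weight [a i] is positive. Unless it is the whole weight, [x] lies strictly between [p i]
    and the normalized combination [z] of the other points, and extremality gives [p i = z]. *)
Lemma vertex_hull (I : finType) (p : I -> V) x :
  vertex (hull p) x -> exists i, x = p i.
Proof.
move=> [[a [a_ge0 a1 xE]] x_extreme].
have [i ai_gt0] : exists i, 0 < a i.
  apply: contrapT => /forallNP a_le0; move: (oner_neq0 R).
  rewrite -a1 big1 ?eqxx // => i _; apply/eqP.
  by rewrite eq_le a_ge0 andbT leNgt; apply/negP/a_le0.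
exists i; rewrite (bigD1 i) //= in a1; rewrite (bigD1 i) //= in xE.
move: a1; set rest := \sum_(j | j != i) a j => a1.
have rest_ge0 : 0 <= rest by apply: sumr_ge0.
have [rest0|rest_neq0] := eqVneq rest 0.
  move: a1; rewrite xE rest0 addr0 => ->; rewrite scale1r big1 ?addr0 // => j ji.
  move/eqP: rest0; rewrite psumr_eq0 // => /allP/(_ j (mem_index_enum _)).
  by rewrite ji => /eqP->; rewrite scale0r.
have restE : 1 - a i = rest by rewrite -a1 addrAC subrr add0r.
pose z := \sum_(j | j != i) (a j / rest) *: p j.
have xz : x = a i *: p i + (1 - a i) *: z.
  rewrite xE restE scaler_sumr; congr (_ + _); apply: eq_bigr => j _.
  by rewrite scalerA mulrCA divff // mulr1.
have z_hull : hull p z.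
  exists (fun j => if j == i then 0 else a j / rest); split=> [j||].
  - by case: eqP => _ //; rewrite divr_ge0.
  - rewrite (bigD1 i) //= eqxx add0r -[RHS](divff rest_neq0) mulr_suml.
    by apply: eq_bigr => j /negPf->.
  - rewrite (bigD1 i) //= eqxx scale0r add0r.
    by apply: eq_bigr => j /negPf->.
have pz : p i = z.
  apply: (x_extreme (p i) z (a i) (hull_mem p i) z_hull _ xz).
  by rewrite ai_gt0 /= -subr_gt0 restE lt_neqAle eq_sym rest_neq0.
by rewrite xz -pz -scalerDl subrKC scale1r.
Qed.

(** This form is visibly stable under Minkowski sums; it is turned into [lattice_polytope] only
    where the hypotheses on the valuation ask for it. *)
Definition lattice_hull P : Prop := exists (I : finType) (p : I -> V),
  (forall i, lattice_point (p i)) /\ P = hull p.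

Lemma lattice_hull_polytope P : lattice_hull P -> lattice_polytope P.
Proof.
move=> [I [p [p_lattice ->]]]; split; last by move=> x /vertex_hull[i ->].
by rewrite conv_hull_enum; eexists; eexists.
Qed.

Lemma lattice_pointD x y :
  lattice_point x -> lattice_point y -> lattice_point (x + y).
Proof. by move=> x_int y_int j; rewrite mxE rpredD ?x_int ?y_int. Qed.

Lemma lattice_point0 : lattice_point (0 : V).
Proof. by move=> j; rewrite mxE rpred0. Qed.

(** One inclusion uses product weights, the other the two marginals. *)
Lemma msum_hull (I J : finType) (p : I -> V) (q : J -> V) :
  msum (hull p) (hull q) = hull (fun ij : I * J => p ij.1 + q ij.2).
Proof.
apply/seteqP; split=> x.
  move=> [_ [_ [[a [a_ge0 a1 ->]] [b [b_ge0 b1 ->]] ->]]].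
  exists (fun ij => a ij.1 * b ij.2); split.
  - by move=> ij; rewrite mulr_ge0.
  - rewrite -(pair_bigA _ (fun i j => a i * b j)) /= -[RHS]a1.
    by apply: eq_bigr => i _; rewrite -mulr_sumr b1 mulr1.
  - rewrite -(pair_bigA _ (fun i j => (a i * b j) *: (p i + q j))) /=.
    have -> : \sum_j b j *: q j = \sum_i \sum_j (a i * b j) *: q j.
      rewrite -[LHS]scale1r -a1 scaler_suml; apply: eq_bigr => i _.
      by rewrite scaler_sumr; apply: eq_bigr => j _; rewrite scalerA.
    rewrite -big_split /=; apply: eq_bigr => i _.
    under [RHS]eq_bigr do rewrite scalerDr.
    by rewrite big_split /= -scaler_suml -mulr_sumr b1 mulr1.
move=> [c [c_ge0 c1 ->]].
exists (\sum_i (\sum_j c (i, j)) *: p i), (\sum_j (\sum_i c (i, j)) *: q j).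
split.
- exists (fun i => \sum_j c (i, j)); split=> // [i|]; first exact: sumr_ge0.
  by rewrite (pair_bigA _ (fun i j => c (i, j))) -c1; apply: eq_bigr => -[].
- exists (fun j => \sum_i c (i, j)); split=> // [j|]; first exact: sumr_ge0.
  rewrite exchange_big (pair_bigA _ (fun i j => c (i, j))) -c1.
  by apply: eq_bigr => -[].
under [X in _ = X + _]eq_bigr do rewrite scaler_suml.
under [X in _ = _ + X]eq_bigr do rewrite scaler_suml.
rewrite [X in _ = _ + X]exchange_big !pair_bigA -big_split /=.
by apply: eq_bigr => -[i j] _; rewrite scalerDr.
Qed.

Lemma lattice_hull_msum P Q :
  lattice_hull P -> lattice_hull Q -> lattice_hull (msum P Q).
Proof.
move=> [I [p [p_int ->]]] [J [q [q_int ->]]].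
exists (I * J)%type, (fun ij => p ij.1 + q ij.2); split; last exact: msum_hull.
by move=> ij; apply: lattice_pointD.
Qed.

Definition is_convex P : Prop := forall x y (t : R), P x -> P y -> 0 <= t <= 1 ->
  P (t *: x + (1 - t) *: y).

Lemma lattice_hull_convex P : lattice_hull P -> is_convex P.
Proof.
move=> [I [p [_ ->]]] _ _ t [a [a_ge0 a1 ->]] [b [b_ge0 b1 ->]] /andP[t0 t1].
exists (fun i => t * a i + (1 - t) * b i); split.
- by move=> i; rewrite addr_ge0 ?mulr_ge0 ?subr_ge0.
- by rewrite big_split /= -!mulr_sumr a1 b1 !mulr1 subrKC.
rewrite !scaler_sumr -big_split; apply: eq_bigr => i _ /=.
by rewrite !scalerA scalerDl.
Qed.

Lemma lattice_hull1 x : lattice_point x -> lattice_hull [set x].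
Proof.
move=> x_int; exists unit, (fun=> x); split=> //.
apply/seteqP; split=> y.
  move=> ->; exists (fun=> 1); split=> //; rewrite big_const card_unit /=.
    by rewrite addr0.
  by rewrite scale1r addr0.
by move=> [a [_ a1 ->]]; rewrite -scaler_suml a1 scale1r.
Qed.

Lemma translateE x P : translate x P = msum [set x] P.
Proof.
apply/seteqP; split=> y; first by move=> [z Pz <-]; exists x, z; rewrite addrC.
by move=> [_ [z [-> Pz ->]]]; exists z; rewrite // addrC.
Qed.

Lemma lattice_hull_translate x P :
  lattice_point x -> lattice_hull P -> lattice_hull (translate x P).
Proof.
by move=> x_int P_hull; rewrite translateE; apply: lattice_hull_msum => //;
  apply: lattice_hull1.
Qed.

Definition seg v : set V := [set t *: v | t in [set t : R | 0 <= t <= 1]].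

Lemma lattice_hull_seg v : lattice_point v -> lattice_hull (seg v).
Proof.
move=> v_int; exists bool, (fun b : bool => if b then v else 0); split.
  by case=> //; apply: lattice_point0.
apply/seteqP; split=> x.
  move=> [t /andP[t0 t1] <-]; exists (fun b : bool => if b then t else 1 - t).
  split; rewrite ?big_bool /= ?scaler0 ?addr0 ?subrKC //.
  by case; rewrite ?subr_ge0.
move=> [a [a_ge0]]; rewrite !big_bool /= => a1 ->.
exists (a true); rewrite ?scaler0 ?addr0 // /= a_ge0 /=.
by rewrite -a1 lerDl a_ge0.
Qed.

(** The vertices are 0, [v] and [v + w]; exchanging [v] and [w] gives the other half of the
    parallelogram. *)
Definition triangle v w : set V :=
  [set x | exists a b : R, 0 <= b <= a /\ a <= 1 /\ x = a *: v + b *: w].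

Lemma lattice_hull_triangle v w : lattice_point v -> lattice_point w ->
  lattice_hull (triangle v w).
Proof.
move=> v_int w_int.
exists (option bool), (fun o => if o is Some b then
  (if b then v + w else v) else 0).
have sumE (U : nmodType) (f : option bool -> U) :
    \sum_o f o = f None + (f (Some true) + f (Some false)).
  rewrite (bigD1 None) //= (bigD1 (Some true)) //= (bigD1 (Some false)) //=.
  by rewrite big1 ?addr0 // => -[[]|].
split; first by case=> [[]|] //; [apply: lattice_pointD | apply: lattice_point0].
apply/seteqP; split=> x.
  move=> [a [b [/andP[b0 ba] [a1 ->]]]].
  exists (fun o => if o is Some c then (if c then b else a - b) else 1 - a).
  rewrite !sumE scaler0 add0r; split=> [[[]|]||]; rewrite ?subr_ge0 //.
    by ring.
  by rewrite scalerDr addrAC -scalerDl subrKC.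
move=> [c [c_ge0]]; rewrite !sumE scaler0 add0r => c1 ->.
exists (c (Some true) + c (Some false)), (c (Some true)); split.
  by rewrite c_ge0 lerDl c_ge0.
split; first by rewrite -c1 lerDr c_ge0.
by rewrite scalerDr addrAC -scalerDl.
Qed.

(** An intermediate value statement, locating where a segment crosses a cut. *)
Lemma crossing (p q : R) : 0 <= p -> q <= 0 ->
  exists t, 0 <= t <= 1 /\ t * p + (1 - t) * q = 0.
Proof.
move=> p0 q0; have [pq|pq] := eqVneq (p - q) 0.
  exists 1; rewrite lexx ler01; split=> //; lra.
exists (- q / (p - q)).
have pq_gt0 : 0 < p - q by rewrite lt_neqAle eq_sym pq subr_ge0 (le_trans q0).
rewrite divr_ge0 ?oppr_ge0 ?(ltW pq_gt0) // ler_pdivrMr // mul1r.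
rewrite lerDr p0; split=> //.
by field.
Qed.

Fixpoint zono s : set V := if s is v :: s' then msum (seg v) (zono s') else [set 0].

Lemma zono_cat s s' : zono (s ++ s') = msum (zono s) (zono s').
Proof. by elim: s => [|v s IH] /=; rewrite ?msum0 // IH msumA. Qed.

Lemma zono_perm s s' : perm_eq s s' -> zono s = zono s'.
Proof.
apply: catCA_perm_subst => s1 s2 s3.
by rewrite !zono_cat !msumA (msumC (zono s1)).
Qed.

Lemma lattice_hull_zono s : {in s, forall v, lattice_point v} ->
  lattice_hull (zono s).
Proof.
elim: s => [_|v s IH s_int] /=; first exact: (lattice_hull1 lattice_point0).
apply: lattice_hull_msum; first by apply/lattice_hull_seg/s_int/mem_head.
by apply: IH => w ws; apply: s_int; rewrite inE ws orbT.
Qed.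

Lemma dilate_zono n s : dilate n (zono s) = zono [seq n%:R *: v | v <- s].
Proof.
elim: s => [|v s IH] /=.
  by rewrite /dilate image_set1 scaler0.
rewrite -IH; apply/seteqP; split=> x.
  move=> [_ [_ [z [[t t01 <-] zz ->]]] <-].
  exists (t *: (n%:R *: v)), (n%:R *: z); split; [by exists t|by exists z|].
  by rewrite scalerDr !scalerA mulrC.
move=> [_ [_ [[t t01 <-] [z zz <-] ->]]].
exists (t *: v + z); last by rewrite scalerDr !scalerA mulrC.
by exists (t *: v), z; split=> //; exists t.
Qed.

Lemma zono_family (I : eqType) (r : seq I) (v : I -> V) : uniq r ->
  zono [seq v i | i <- r] =
  [set x | exists a : I -> R, (forall i, 0 <= a i <= 1) /\
             x = \sum_(i <- r) a i *: v i].
Proof.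
elim: r => [_|i r IH /= /andP[i_r r_uniq]] /=.
  apply/seteqP; split=> x; last by move=> [a [_ ->]]; rewrite big_nil.
  by move=> ->; exists (fun=> 0); rewrite lexx ler01 big_nil.
rewrite IH //; apply/seteqP; split=> x.
  move=> [_ [_ [[t t01 <-] [a [a01 ->]] ->]]].
  exists (fun j => if j == i then t else a j); split=> [j|].
    by case: eqP.
  rewrite big_cons eqxx; congr (_ + _); apply: eq_big_seq => j jr.
  by case: eqP => // ji; rewrite -ji jr in i_r.
move=> [a [a01 ->]]; rewrite big_cons; exists (a i *: v i).
exists (\sum_(j <- r) a j *: v j); split=> //; last by exists a.
by exists (a i) => //=; apply: a01.
Qed.

(** * Valuations of Minkowski sums under cuts *)

Section Cut.
Variables (G : zmodType) (phi : set V -> G).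
Hypothesis phi_val : Zd_valuation phi.

(* Adding a convex body preserves the decomposition of [T1 `|` T2], because
   every segment from [T1] to [T2] meets [T3]. *)
Lemma valuation_cut T1 T2 T3 K :
  lattice_hull (T1 `|` T2) -> lattice_hull T1 -> lattice_hull T2 ->
  lattice_hull T3 -> lattice_hull K -> T3 `<=` T1 `&` T2 ->
  (forall x y, T1 x -> T2 y -> exists t : R, 0 <= t <= 1 /\
     T3 (t *: x + (1 - t) *: y)) ->
  phi (msum (T1 `|` T2) K) =
  phi (msum T1 K) + phi (msum T2 K) - phi (msum T3 K).
Proof.
move=> T_hull T1_hull T2_hull T3_hull K_hull T3_sub T3_meet.
have unionE : msum (T1 `|` T2) K = msum T1 K `|` msum T2 K.
  apply/seteqP; split=> x.
    by move=> [y [z [[Ty|Ty] Kz ->]]]; [left|right]; exists y, z.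
  by case=> -[y [z [Ty Kz ->]]]; exists y, z; split=> //; [left|right].
have interE : msum T1 K `&` msum T2 K = msum T3 K.
  apply/seteqP; split=> x; last first.
    by move=> [y [z [/T3_sub[T1y T2y] Kz ->]]]; split; exists y, z.
  move=> [[y [z [T1y Kz xE]]] [y' [z' [T2y' Kz' xE']]]].
  (* Averaging the two decompositions of [x] with this weight leaves [x] fixed, puts the first
     summand in [T3] and keeps the second in the convex set [K]. *)
  have [t [t01 T3yy']] := T3_meet _ _ T1y T2y'.
  exists (t *: y + (1 - t) *: y'), (t *: z + (1 - t) *: z'); split=> //.
    exact: lattice_hull_convex.
  by rewrite addrACA -!scalerDr -xE -xE' -scalerDl subrKC scale1r.
case: phi_val => _ phiU _; rewrite unionE phiU.
- by rewrite interE.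
- exact/lattice_hull_polytope/lattice_hull_msum.
- exact/lattice_hull_polytope/lattice_hull_msum.
- by rewrite -unionE; exact/lattice_hull_polytope/lattice_hull_msum.
- by rewrite interE; exact/lattice_hull_polytope/lattice_hull_msum.
Qed.

Lemma valuation_translate x K : lattice_hull K -> lattice_point x ->
  phi (translate x K) = phi K.
Proof. by case: phi_val => _ _ phiT /lattice_hull_polytope; apply: phiT. Qed.

(* The diagonal cuts the parallelogram of [v] and [w] into two triangles, which
   reassemble along [w] to the parallelogram of [v] and [v + w]. *)
Lemma valuation_shear v w K : lattice_point v -> lattice_point w ->
  lattice_hull K ->
  phi (msum (seg v) (msum (seg w) K)) - phi (msum (seg w) K) =
  phi (msum (seg v) (msum (seg (v + w)) K)) - phi (msum (seg (v + w)) K).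
Proof.
move=> v_int w_int K_hull; have vw_int := lattice_pointD v_int w_int.
have T1_hull := lattice_hull_triangle v_int w_int.
have T2_hull := lattice_hull_triangle w_int v_int.
have parE : msum (seg v) (seg w) = triangle v w `|` triangle w v.
  apply/seteqP; split=> x.
    move=> [_ [_ [[a /andP[a0 a1] <-] [b /andP[b0 b1] <-] ->]]].
    have [le_ba|/ltW le_ab] := leP b a; first by left; exists a, b; rewrite b0.
    by right; exists b, a; rewrite a0 addrC.
  case=> -[a [b [/andP[b0 ba] [a1 ->]]]]; last rewrite addrC.
    exists (a *: v), (b *: w); split=> //.
      by exists a; rewrite //= a1 (le_trans b0 ba).
    by exists b; rewrite //= b0 (le_trans ba a1).
  exists (b *: v), (a *: w); split=> //.
    by exists b; rewrite //= b0 (le_trans ba a1).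
  by exists a; rewrite //= a1 (le_trans b0 ba).
have parE' : msum (seg v) (seg (v + w)) =
    triangle v w `|` translate v (triangle w v).
  apply/seteqP; split=> x.
    move=> [_ [_ [[a /andP[a0 a1] <-] [b /andP[b0 b1] <-] ->]]].
    have [le_ab1|/ltW le_1ab] := leP (a + b) 1.
      left; exists (a + b), b; split; first by rewrite b0 lerDr a0.
      by split=> //; rewrite scalerDr scalerDl addrA.
    right; exists (b *: w + (a + b - 1) *: v).
      exists b, (a + b - 1); split=> //.
      by apply/andP; split; lra.
    rewrite scalerBl scalerDl scale1r scalerDr addrA subrK.
    by rewrite addrC addrA.
  case=> [[a [b [/andP[b0 ba] [a1 ->]]]]|[_ [a [b [/andP[b0 ba] [a1 ->]]]] <-]].
    exists ((a - b) *: v), (b *: (v + w)); split.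
    - by exists (a - b) => //=; apply/andP; split; lra.
    - by exists b => //=; apply/andP; split; lra.
    - by rewrite scalerDr addrA -scalerDl subrK.
  exists ((1 + b - a) *: v), (a *: (v + w)); split.
  - by exists (1 + b - a) => //=; apply/andP; split; lra.
  - by exists a => //=; apply/andP; split; lra.
  - rewrite scalerDr addrA -scalerDl subrK scalerDl scale1r.
    by rewrite [LHS]addrC [a *: w + _]addrC addrA.
have cut1 : phi (msum (msum (seg v) (seg w)) K) =
    phi (msum (triangle v w) K) + phi (msum (triangle w v) K) -
    phi (msum (seg (v + w)) K).
  have par_hull := lattice_hull_msum (lattice_hull_seg v_int) (lattice_hull_seg w_int).
  rewrite parE in par_hull *; apply: valuation_cut => //.
  - exact: lattice_hull_seg.
  - move=> _ [t /andP[t0 t1] <-].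
    by split; exists t, t; rewrite t0 lexx t1 -scalerDr // addrC.
  - move=> _ _ [a [b [/andP[b0 ba] [a1 ->]]]] [a' [b' [/andP[b'0 b'a'] [a'1 ->]]]].
    (* The weight at which the coefficients of [v] and [w] agree, on the diagonal. *)
    have [t [/andP[t0 t1] tE]] : exists t, 0 <= t <= 1 /\
        t * (a - b) + (1 - t) * (b' - a') = 0.
      by apply: crossing; rewrite ?subr_ge0 ?subr_le0.
    exists t; rewrite t0 t1; split=> //.
    exists (t * a + (1 - t) * b').
      have t1' : 0 <= 1 - t by rewrite subr_ge0.
      by apply/andP; split; nra.
    have tE' : t * b + (1 - t) * a' = t * a + (1 - t) * b' by lra.
    rewrite [LHS]scalerDr -{2}tE' !scalerDr !scalerA !scalerDl.
    by rewrite [in RHS](addrC (_ *: w)) addrACA.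
(* The second triangle is now translated by [v], and the common edge is the translate of [seg w]. *)
have cut2 : phi (msum (msum (seg v) (seg (v + w))) K) =
    phi (msum (triangle v w) K) + phi (msum (triangle w v) K) -
    phi (msum (seg w) K).
  have par_hull :=
    lattice_hull_msum (lattice_hull_seg v_int) (lattice_hull_seg vw_int).
  rewrite parE' in par_hull *.
  have -> : phi (msum (triangle w v) K) =
            phi (msum (translate v (triangle w v)) K).
    rewrite msum_translate valuation_translate //.
    exact: lattice_hull_msum.
  have -> : phi (msum (seg w) K) = phi (msum (translate v (seg w)) K).
    rewrite msum_translate valuation_translate //.
    exact: lattice_hull_msum (lattice_hull_seg w_int) K_hull.
  have w_hull := lattice_hull_translate v_int (lattice_hull_seg w_int).
  have T2'_hull := lattice_hull_translate v_int T2_hull.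
  apply: valuation_cut => //.
  - move=> _ [_ [t /andP[t0 t1] <-] <-]; split.
      by exists 1, t; rewrite t0 t1 lexx scale1r addrC.
    by exists (t *: w) => //; exists t, 0; rewrite lexx t0 t1 scale0r addr0.
  - move=> _ _ [a [b [/andP[b0 ba] [a1 ->]]]]
             [_ [a' [b' [/andP[b'0 b'a'] [a'1 ->]]]] <-].
    (* The weight at which the coefficient of [v] equals 1, on the common edge. *)
    have [t [/andP[t0 t1] tE]] : exists t, 0 <= t <= 1 /\
        t * (1 - a) + (1 - t) * (- b') = 0.
      by apply: crossing; rewrite ?subr_ge0 ?oppr_le0.
    exists t; rewrite t0 t1; split=> //.
    exists ((t * b + (1 - t) * a') *: w).
      exists (t * b + (1 - t) * a') => //=.
      have t1' : 0 <= 1 - t by rewrite subr_ge0.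
      by apply/andP; split; nra.
    have vE : t * a + (1 - t) * b' + (1 - t) = 1 by lra.
    apply/rowP => j; rewrite !mxE -[X in _ + X = _]mul1r -[X in _ + X * _ = _]vE.
    by ring.
rewrite [msum (seg v) (msum (seg w) K)]msumA cut1 msumA cut2.
by rewrite addrAC.
Qed.

(** Cut the long segment at the lattice point [n v]; translation invariance brings the last piece
    and the cut point back to the origin. *)
Lemma valuation_segS (n : nat) v K : lattice_point v -> lattice_hull K ->
  phi (msum (seg (n.+1%:R *: v)) K) =
  phi (msum (seg (n%:R *: v)) K) + phi (msum (seg v) K) - phi K.
Proof.
move=> v_int K_hull.
have nv_int m : lattice_point (m%:R *: v : V).
  by move=> j; rewrite mxE rpredM ?natr_int ?v_int.
have nv_hull m := lattice_hull_seg (nv_int m).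
have segE : seg (n.+1%:R *: v) = seg (n%:R *: v) `|` translate (n%:R *: v) (seg v).
  apply/seteqP; split=> x.
    move=> [t /andP[t0 t1] <-].
    have [le_tn|/ltW le_nt] := leP (t * n.+1%:R) n%:R.
      left; have [n0|n_gt0] := posnP n.
        exists 0; first by rewrite /= lexx ler01.
        have -> : t = 0 by move: le_tn; rewrite n0 mulr1; lra.
        by rewrite !scale0r.
      have n0 : n%:R != 0 :> R by rewrite pnatr_eq0 -lt0n.
      exists (t * n.+1%:R / n%:R); last by rewrite !scalerA divfK.
      rewrite /= divr_ge0 ?mulr_ge0 ?ler0n //=.
      by rewrite ler_pdivrMr ?ltr0n // mul1r.
    right; exists ((t * n.+1%:R - n%:R) *: v); last by rewrite -scalerDl subrK scalerA.
    exists (t * n.+1%:R - n%:R) => //=; rewrite subr_ge0 le_nt /= lerBlDl -natr1.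
    by rewrite ler_piMl // addr_ge0 ?ler0n.
  case=> [[t /andP[t0 t1] <-]|[_ [t /andP[t0 t1] <-] <-]].
    exists (t * n%:R / n.+1%:R); last by rewrite !scalerA divfK ?pnatr_eq0.
    rewrite /= divr_ge0 ?mulr_ge0 ?ler0n //= ler_pdivrMr ?ltr0n // mul1r.
    rewrite (le_trans (ler_piMl _ t1)) ?ler0n // ler_nat; lia.
  exists ((t + n%:R) / n.+1%:R).
    rewrite /= divr_ge0 ?addr_ge0 ?ler0n //= ler_pdivrMr ?ltr0n // mul1r.
    by rewrite -natr1 addrC lerD2l.
  by rewrite scalerA divfK ?pnatr_eq0 // scalerDl.
have -> : phi (msum (seg v) K) = phi (msum (translate (n%:R *: v) (seg v)) K).
  rewrite msum_translate valuation_translate //.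
  exact: lattice_hull_msum (lattice_hull_seg v_int) K_hull.
have -> : phi K = phi (msum [set n%:R *: v] K).
  by rewrite -translateE valuation_translate.
have := nv_hull n.+1; rewrite segE => nSv_hull.
apply: valuation_cut => //.
- exact: lattice_hull_translate (lattice_hull_seg v_int).
- exact: lattice_hull1.
- move=> _ ->; split.
    by exists 1; rewrite ?scale1r //= ler01 lexx.
  by exists 0; rewrite ?add0r //; exists 0; rewrite ?scale0r //= lexx ler01.
move=> _ _ [a /andP[a0 a1] <-] [_ [b /andP[b0 b1] <-] <-].
have n_ge0 : 0 <= n%:R :> R := ler0n _ _.
have [t [t01 tE]] : exists t, 0 <= t <= 1 /\
    t * (n%:R - a * n%:R) + (1 - t) * (- b) = 0.
  apply: crossing; rewrite ?oppr_le0 // subr_ge0 ler_piMl //.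
exists t; split=> //=.
rewrite scalerDr !scalerA -!scalerDl; congr (_ *: _); lra.
Qed.

End Cut.
End Geometry.

(** * Ranks of integer vectors *)

Section Rank.
Variables (R : realType) (d : nat).
Local Notation V := 'rV[R]_d.
Local Notation Vint := 'rV[int]_d.
Implicit Types (v w : Vint) (s t L S : seq Vint).

Definition real_row v : V := map_mx intr v.

Definition rk s : nat := \dim <<map real_row s>>.

Lemma rk_nil : rk [::] = 0%N.
Proof. by rewrite /rk span_nil dimv0. Qed.

Lemma rk_perm s t : perm_eq s t -> rk s = rk t.
Proof.
move=> st; rewrite /rk (eq_span (Y := map real_row t)) //.
by apply: perm_mem; apply: perm_map.
Qed.

Lemma rk_cons_in v s : real_row v \in <<map real_row s>>%VS -> rk (v :: s) = rk s.
Proof.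
move=> v_s; rewrite /rk /= span_cons; congr (\dim _).
by apply/addv_idPr; rewrite -memvE.
Qed.

Lemma rk_cons_notin v s : real_row v \notin <<map real_row s>>%VS ->
  rk (v :: s) = (rk s).+1.
Proof.
move=> v_s; rewrite /rk /= span_cons.
have v_neq0 : real_row v != 0 by apply: contraNneq v_s => ->; rewrite mem0v.
rewrite dimv_disjoint_sum ?dim_vline ?v_neq0 //.
apply/eqP; rewrite -subv0; apply/subvP => x /memv_capP[/vlineP[a ->]].
have [->|a_neq0] := eqVneq a 0; first by rewrite scale0r => _; apply: mem0v.
move=> av_s; case/negP: v_s.
by rewrite -[real_row v]scale1r -(mulVf a_neq0) -scalerA memvZ.
Qed.

Lemma rk_cons_le v s : (rk (v :: s) <= (rk s).+1)%N.
Proof.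
have [v_s|v_s] := boolP (real_row v \in <<map real_row s>>%VS).
  by rewrite rk_cons_in.
by rewrite rk_cons_notin.
Qed.

Lemma rk_cat_le s t : (rk (s ++ t) <= size s + rk t)%N.
Proof.
by elim: s => //= v s IH; apply: leq_trans (rk_cons_le _ _) _; rewrite ltnS.
Qed.

Lemma free_rk s : free (map real_row s) = (rk s == size s).
Proof. by rewrite /free size_map. Qed.

(** Rank does not change under field extension, so real dependence of integer vectors gives a
    rational relation; then denominators are cleared. *)
Lemma integer_relation L : ~~ free (map real_row L) ->
  exists M : seq (int * Vint), [/\ map snd M = L,
    \sum_(p <- M) p.1 *: p.2 = 0 & has (fun p => p.1 != 0) M].
Proof.
set n := size L => L_dep.
pose Lint : 'M[int]_(n, d) := \matrix_(i < n) L`_i.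
pose Lrat : 'M[rat]_(n, d) := map_mx intr Lint.
have [u u_neq0 uL] : exists2 u : 'rV[rat]_n, u != 0 & u *m Lrat = 0.
  have: ~~ row_free Lrat.
    rewrite -(row_free_map (ratr : {rmorphism rat -> R})).
    apply: contra L_dep => free_L.
    rewrite -[map _ _]/(tval (map_tuple real_row (in_tuple L))).
    apply/freeP => k k0 i.
    suff /rowP/(_ i) : \row_i k i = 0 :> 'rV_n by rewrite !mxE.
    apply: (row_free_inj free_L); rewrite mul0mx -k0; apply/rowP => j.
    rewrite !mxE summxE; apply: eq_bigr => l _.
    by rewrite (nth_map 0) ?ltn_ord // /Lrat /Lint !mxE /= ratr_int.
  rewrite -kermx_eq0 => /rowV0Pn[u u_ker u_neq0]; exists u => //.
  exact/sub_kermxP.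
(* The rational relation is stored as a polynomial to get a common denominator [a] for its
   entries. *)
have [q [a a_neq0 qE]] :=
  rat_poly_scale (\poly_(i < n) (if insub i is Some k then u 0 k else 0)).
have uE (i : 'I_n) : (q`_i)%:~R = a%:~R * u 0 i.
  move/(congr1 (fun p : {poly rat} => p`_i)): qE.
  rewrite coef_poly ltn_ord valK coefZ coef_map_id0 //= => ->.
  by rewrite mulrA divff ?intr_eq0 // mul1r.
exists [seq (q`_i, L`_i) | i <- iota 0 n]; split.
- by rewrite -map_comp map_nth_iota0 ?take_size.
- rewrite big_map -{1}(subn0 n) -/(index_iota 0 n) big_mkord.
  apply/rowP => j; apply: (@intr_inj rat); rewrite summxE !mxE.
  have /rowP/(_ j) := uL; rewrite !mxE => uLj.
  rewrite rmorph_sum -[RHS](mulr0 a%:~R) -[in RHS]uLj mulr_sumr.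
  by apply: eq_bigr => i _; rewrite /Lrat /Lint !mxE /= intrM uE mulrA.
- apply/hasP; have [i ui] : exists i, u 0 i != 0.
    apply: contrapT => /forallNP u0; case/eqP: u_neq0.
    by apply/rowP => i; rewrite mxE; apply/eqP/negbNE/negP/u0.
  exists (q`_i, L`_i); first by apply: map_f; rewrite mem_iota ltn_ord.
  by rewrite /= -(intr_eq0 rat) uE mulf_neq0 ?intr_eq0.
Qed.

Lemma zono_span (s : seq V) x : zono s x -> x \in <<s>>%VS.
Proof.
elim: s x => [|v s IH] x; first by move=> ->; rewrite mem0v.
move=> [_ [y [[t _ <-] /IH ys ->]]]; rewrite span_cons.
by apply: memv_add => //; apply: memvZ; apply: memv_line.
Qed.

Lemma zono0 (s : seq V) : zono s 0.
Proof.
elim: s => //= v s IH; exists 0, 0; split; rewrite ?addr0 //.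
by exists 0; rewrite ?scale0r //= lexx ler01.
Qed.

Lemma zono_mem (s : seq V) (v : V) : v \in s -> zono s v.
Proof.
elim: s => //= w s IH; rewrite inE => /orP[/eqP->|/IH v_s].
  exists w, 0; split; rewrite ?addr0 //; last exact: zono0.
  by exists 1; rewrite ?scale1r //= lexx ler01.
exists 0, v; split; rewrite ?add0r //.
by exists 0; rewrite ?scale0r //= lexx ler01.
Qed.

(** The zonotope contains 0 and all generators, so 0 can absorb the weight that makes a linear
    combination affine. *)
Lemma affine_hull_zono (s : seq V) :
  affine_hull (zono s) = [set x | x - 0 \in <<s>>%VS].
Proof.
apply/seteqP; split=> x.
  move=> [n [p [a [p_zono _ ->]]]]; rewrite /= subr0.
  by apply: memv_suml => i _; apply: memvZ; apply: zono_span.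
rewrite /= subr0 => /(@coord_span _ _ _ (in_tuple s)) ->.
set n := size s; set c := coord (in_tuple s).
exists n.+1, (fun k : 'I_n.+1 => if unlift ord0 k is Some i then s`_i else 0).
exists (fun k : 'I_n.+1 => if unlift ord0 k is Some i then c i x
                           else 1 - \sum_i c i x).
split.
- move=> k; case: unliftP => [i _|_]; last exact: zono0.
  by apply: zono_mem; apply: mem_nth.
- rewrite big_ord_recl unlift_none.
  by under [X in _ + X]eq_bigr do rewrite liftK; rewrite subrK.
- rewrite big_ord_recl unlift_none scaler0 add0r.
  by apply: eq_bigr => i _; rewrite liftK.
Qed.

Lemma zono_has_dim (s : seq V) : free s -> has_dim (zono s) (size s).
Proof.
move=> s_free; exists 0, <<s>>%VS; split; first exact/eqP.
exact: affine_hull_zono.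
Qed.

Lemma zono_full_dim (s : seq V) (w : V) :
  has_dim (translate w (zono s)) d -> \dim <<s>> = d.
Proof.
move=> [x0 [U [U_dim hullE]]].
have U_full : U = fullv.
  by apply/eqP; rewrite eqEdim subvf dimvf /dim /= U_dim mul1n leqnn.
have -> : <<s>>%VS = fullv; last by rewrite dimvf /dim /= mul1n.
apply/vspaceP => x; rewrite memvf.
have : affine_hull (translate w (zono s)) (x + w).
  by rewrite hullE /= U_full memvf.
move=> [n [p [a [p_zono a1 xE]]]].
(* The weights sum to 1, so the translation by [w] cancels. *)
have -> : x = \sum_i a i *: (p i - w).
  under eq_bigr do rewrite scalerBr.
  by rewrite sumrB -xE -scaler_suml a1 scale1r addrK.
apply: memv_suml => i _; apply: memvZ.
by have [y /zono_span ys <-] := p_zono i; rewrite addrK.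
Qed.

End Rank.

(** * Valuations of zonotopes *)

Section ZonotopeValuation.
Variables (R : realType) (d : nat) (G : zmodType) (phi : set 'rV[R]_d -> G).
Hypothesis phi_val : Zd_valuation phi.
Local Notation Vint := 'rV[int]_d.
Implicit Types (v w : Vint) (s t ws : seq Vint).

(** Generators are integer rows, the setting of Euclid's algorithm in [app_dop_dependent]. *)
Definition zono_val s : G := phi (zono (map (@real_row R d) s)).

Lemma lattice_point_real_row v : lattice_point (real_row R v).
Proof. by move=> j; rewrite mxE intr_int. Qed.

Lemma lattice_hull_zono_row s : lattice_hull (zono (map (@real_row R d) s)).
Proof.
by apply: lattice_hull_zono => _ /mapP[v _ ->]; apply: lattice_point_real_row.
Qed.

Lemma zono_val_zonal : zonal zono_val.
Proof.
split=> [s t st|v w s|s]; rewrite /zono_val.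
- by rewrite (zono_perm (perm_map _ st)).
- rewrite /=.
  have -> : real_row R (v + w) = real_row R v + real_row R w by exact: map_mxD.
  apply: valuation_shear => //; try exact: lattice_point_real_row.
  exact: lattice_hull_zono_row.
- rewrite /=; have -> : real_row R 0 = 0 :> 'rV[R]_d by exact: map_mx0.
  suff -> : seg (0 : 'rV[R]_d) = [set 0] by rewrite msum0.
  apply/seteqP; split=> x; first by move=> [t _ <-]; rewrite scaler0.
  by move=> ->; exists 0; rewrite ?scale0r //= lexx ler01.
Qed.

(** In operator form [E_(n v) = 1 + n D_v]; one copy of [v] is cut off at a time. *)
Lemma zono_val_muln n v s :
  zono_val ((v *+ n) :: s) = zono_val (v :: s) *~ n + zono_val s *~ (1 - n%:Z).
Proof.
have rowE m : real_row R (v *+ m) = m%:R *: real_row R v.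
  by rewrite scaler_nat /real_row raddfMn.
elim: n => [|n IH].
  by case: zono_val_zonal => _ _ F0; rewrite mulr0n F0 mulr0z subr0 mulr1z add0r.
have := valuation_segS phi_val n (lattice_point_real_row v) (lattice_hull_zono_row s).
rewrite -!rowE => segS.
have {segS} -> : zono_val ((v *+ n.+1) :: s) =
    zono_val ((v *+ n) :: s) + zono_val (v :: s) - zono_val s by [].
have -> : zono_val (v :: s) *~ n.+1 = zono_val (v :: s) *~ n + zono_val (v :: s).
  by rewrite intS addrC mulrzDr mulr1z.
have -> : zono_val s *~ (1 - n.+1%:Z) = zono_val s *~ (1 - n%:Z) - zono_val s.
  by rewrite -[X in _ = _ - X]mulr1z -mulrzBr; congr (_ *~ _); lia.
by rewrite IH addrA; congr (_ - _); rewrite addrAC.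
Qed.

Lemma app_eop_zono_val n ws s :
  app (map (eop n) ws) zono_val s = zono_val (map (fun v => v *+ n) ws ++ s).
Proof.
have [F_perm _ _] := zono_val_zonal.
elim: ws s => //= v ws IH s; rewrite app_cons !IH zono_val_muln.
congr (_ *~ _ + _); apply: F_perm.
by rewrite -cat1s perm_catCA.
Qed.

Lemma val_dilate_zono n s :
  phi (dilate n (zono (map (@real_row R d) s))) =
  app (map (eop n) s) zono_val [::].
Proof.
rewrite app_eop_zono_val cats0 /zono_val dilate_zono; congr (phi (zono _)).
rewrite -!map_comp; apply: eq_map => v /=.
by rewrite scaler_nat /real_row raddfMn.
Qed.

Lemma app_dop_not_free s t : ~~ free (map (@real_row R d) s) ->
  app (map (@dop _) s) zono_val t = 0.
Proof.
move=> /integer_relation[M [<- M0 M_neq0]]; rewrite -map_comp.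
exact: (app_dop_dependent zono_val_zonal).
Qed.

End ZonotopeValuation.

(** * Nonnegative expansions by deletion-contraction *)

Section CombinatoriallyPositive.
Variables (R : realType) (d : nat) (G : porderZmodType).
Variable phi : set 'rV[R]_d -> G.
Hypotheses (G_order : translation_invariant_order G)
           (phi_pos : combinatorially_positive phi).
Local Notation Vint := 'rV[int]_d.
Local Notation rk := (@rk R d).
Implicit Types (v w : Vint) (s t ws L S : seq Vint).

Let phi_val : Zd_valuation phi. Proof. by case: phi_pos. Qed.
Let F := zono_val phi.
Let F_zonal : zonal F := zono_val_zonal phi_val.
Let F_perm : perm_invariant F. Proof. by case: F_zonal. Qed.

Lemma order_addr_ge0 (x y : G) : 0 <= x -> 0 <= y -> 0 <= x + y.
Proof.
by move=> x0 y0; apply: le_trans y0 _; rewrite -[X in X <= _]add0r G_order.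
Qed.

Lemma order_sumr_ge0 (I : finType) (f : I -> G) :
  (forall i, 0 <= f i) -> 0 <= \sum_i f i.
Proof. by move=> f0; elim/big_ind: _ => // x y; apply: order_addr_ge0. Qed.

Lemma order_subr_ge0 (x y : G) : (0 <= y - x) = (x <= y).
Proof.
apply/idP/idP => le_xy.
  by have := G_order x le_xy; rewrite add0r subrK.
by have := G_order (- x) le_xy; rewrite subrr.
Qed.

Lemma hstar_bdiff P r i :
  hstar phi P r i = iter r.+1 (@bdiff G) (fun n => phi (dilate n P)) i.
Proof. exact: (sum_coef_bdiff (fun n => phi (dilate n P))). Qed.

(* The top h*-coefficient of a lattice parallelepiped is the value of the
   valuation on its interior. *)
Lemma app_bop_ge0 S : free (map (@real_row R d) S) ->
  0 <= app (map (@bop _) S) F [::].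
Proof.
move=> S_free; have [c [cE ctop]] := app_eop_expansion S [::] [::] F_perm.
rewrite -[map _ S]cats0 -ctop -(bdiff_cube_expansion_top cE).
have zonoE n : app (map (eop n) S ++ [::]) F [::] =
    phi (dilate n (zono (map (@real_row R d) S))).
  by rewrite cats0 val_dilate_zono.
rewrite (eq_iter_bdiff _ zonoE) -hstar_bdiff.
case: phi_pos => _; apply=> //.
  exact/lattice_hull_polytope/lattice_hull_zono_row.
by rewrite -(size_map (@real_row R d)); apply: zono_has_dim.
Qed.

Definition positive_expansion r (f : nat -> G) : Prop :=
  exists c, (forall k, 0 <= c k) /\ cube_expansion r c f.

Lemma eq_positive_expansion r f g : f =1 g ->
  positive_expansion r f -> positive_expansion r g.
Proof. by move=> /funext->. Qed.

Lemma positive_expansionD r f g : positive_expansion r f ->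
  positive_expansion r g -> positive_expansion r (fun n => f n + g n).
Proof.
move=> [c1 [c1_ge0 c1E]] [c2 [c2_ge0 c2E]]; exists (fun k => c1 k + c2 k).
split=> [k|n]; first exact: order_addr_ge0.
rewrite c1E c2E -big_split; apply: eq_bigr => k _.
by rewrite /= mulrzDl.
Qed.

Lemma positive_expansionS r f g :
  positive_expansion r f -> positive_expansion r g ->
  positive_expansion r.+1 (fun n => f n *~ n.+1 + g n *~ n).
Proof.
move=> [c1 [c1_ge0 c1E]] [c2 [c2_ge0 c2E]].
eexists; split; last exact: cube_expansionS c1E c2E.
move=> k; apply: order_addr_ge0; first by case: ifP.
by case: k.
Qed.

Lemma positive_expansion0 r : positive_expansion r (fun=> 0).
Proof.
exists (fun=> 0); split=> // n.
by rewrite big1 // => k _; rewrite mul0rz.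
Qed.

Lemma app_map_ndop n s t : app (map (ndop n) s) F t =
  app (map (@dop _) s) F t *~ (n%:Z ^+ size s).
Proof.
elim: s t => [|v s IH] t; first by rewrite expr0 mulr1z.
rewrite /= !app_cons !IH exprS mulrzDl -!mulrzA.
by congr (_ *~ _ + _ *~ _); ring.
Qed.

(* Deletion-contraction on the first unprocessed generator [w]: it is a loop over
   [L], or a coloop, which can be cut off as a factor [(n + 1) + n B_w], or else
   the expression splits as [1 + n D_w] with [w] deleted or moved to [L]. *)
Lemma deletion_contraction ws S L :
  free (map (@real_row R d) L) -> rk (S ++ L ++ ws) = (size S + rk (L ++ ws))%N ->
  positive_expansion (rk (L ++ ws)) (fun n =>
    app (map (@bop _) S ++ map (ndop n) L ++ map (eop n) ws) F [::]).
Proof.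
(* The rank hypothesis says that [S] is independent and its span meets that of [L ++ ws] trivially,
   which finally makes [app_bop_ge0] applicable. *)
elim: ws S L => [|w ws IH] S L.
  rewrite !cats0 !free_rk => /eqP rkL; rewrite rkL.
  (* With no generator left, [n D_l = n + n B_l] either drops [l] or moves it to [S]; the part with
     factor [n + 1] is zero. *)
  elim: L S rkL => [|l L IHL] S rkL rkSL.
    exists (fun=> app (map (@bop _) S) F [::]); split=> [_|n].
      by apply: app_bop_ge0; rewrite free_rk -{1}[S]cats0 rkSL addn0.
    by rewrite big_ord1 !cats0 mulr1z.
  have rkL' : rk L = size L.
    apply/eqP; rewrite eqn_leq -{1}[L]cats0 (leq_trans (rk_cat_le _ _ _)) /=.
      by have := rk_cons_le R l L; rewrite rkL.
    by rewrite -{2}[size L]addn0 leq_add2l rk_nil.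
  have lSL : perm_eq (S ++ l :: L) (l :: S ++ L).
    by rewrite -cat1s perm_catCA.
  have rkSL' : rk (S ++ L) = (size S + size L)%N.
    apply/eqP; rewrite eqn_leq -{1}rkL' rk_cat_le /=.
    by have := rk_cons_le R l (S ++ L); rewrite -(rk_perm _ lSL) rkSL addnS.
  have pos1 := IHL S rkL' rkSL'.
  have pos2 := IHL (l :: S) rkL' (etrans (esym (rk_perm R lSL)) _).
  apply: eq_positive_expansion (positive_expansionS (positive_expansion0 _)
    (positive_expansionD pos1 (pos2 _))) => [n|]; last by rewrite rkSL addnS.
  by rewrite !cats0 /= mul0rz add0r app_front // app_ndop mulrzDl.
move=> L_free rkSLw.
have midL os : perm_eq (L ++ w :: os) (w :: L ++ os) by rewrite -cat1s perm_catCA.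
have midSL : perm_eq (S ++ L ++ w :: ws) (w :: S ++ L ++ ws).
  by rewrite !catA -cat1s perm_catCA.
rewrite (rk_perm _ (midL ws)).
move: rkSLw; rewrite (rk_perm _ midSL) (rk_perm _ (midL ws)) => rkSLw.
have mid n o : app (map (@bop _) S ++ map (ndop n) L ++ o :: map (eop n) ws) F [::]
    = app (o :: map (@bop _) S ++ map (ndop n) L ++ map (eop n) ws) F [::].
  by rewrite !catA app_front.
have span_ws : (<<map (@real_row R d) L>> <= <<map (@real_row R d) (L ++ ws)>>)%VS.
  by apply: sub_span => x; rewrite map_cat mem_cat => ->.
have span_S : (<<map (@real_row R d) (L ++ ws)>> <=
               <<map (@real_row R d) (S ++ L ++ ws)>>)%VS.
  by apply: sub_span => x xLws; rewrite map_cat mem_cat xLws orbT.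
(* If [w] depends on [L], the product of [D_w] with the operators of [L] vanishes, so [1 + n D_w]
   acts as 1. *)
have [w_L|w_L] := boolP (real_row R w \in <<map (@real_row R d) L>>%VS).
  have w_Lws := subvP span_ws _ w_L; have w_SLws := subvP span_S _ w_Lws.
  rewrite !rk_cons_in // in rkSLw *.
  apply: eq_positive_expansion (IH S L L_free rkSLw) => n.
  rewrite /= mid app_eop -[LHS]addr0; congr (_ + _).
  rewrite (app_perm (os' := (map (@bop _) S ++ map (eop n) ws) ++
                            map (ndop n) (w :: L))) //; last first.
    by rewrite perm_sym perm_catC /= perm_cons perm_catCA.
  rewrite app_cat app_eq0 // => s; rewrite app_map_ndop app_dop_not_free ?mul0rz //.
  by move: L_free; rewrite !free_rk rk_cons_in //= => /eqP->; rewrite ltn_eqF.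
have wL_free : free (map (@real_row R d) (w :: L)).
  by move: L_free; rewrite !free_rk rk_cons_notin //= eqSS.
have [w_Lws|w_Lws] := boolP (real_row R w \in <<map (@real_row R d) (L ++ ws)>>%VS).
  have w_SLws := subvP span_S _ w_Lws.
  rewrite rk_cons_in //.
  move: (rkSLw); rewrite !rk_cons_in // => rkSL.
  have pos2 := IH S (w :: L) wL_free.
  rewrite (rk_cons_in w_Lws) in pos2.
  have midS : perm_eq (S ++ (w :: L) ++ ws) (w :: S ++ L ++ ws).
    exact: permEl (perm_catCA S [:: w] (L ++ ws)).
  rewrite (rk_perm _ midS) (rk_cons_in w_SLws) in pos2.
  apply: eq_positive_expansion
    (positive_expansionD (IH S L L_free rkSL) (pos2 rkSL)) => n.
  by rewrite /= mid app_eop; congr (_ + _); rewrite app_front.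
rewrite rk_cons_notin //.
have rkSLw' : rk (w :: S ++ L ++ ws) = (size S + (rk (L ++ ws)).+1)%N.
  by rewrite rkSLw rk_cons_notin.
have rkSL : rk (S ++ L ++ ws) = (size S + rk (L ++ ws))%N.
  apply/eqP; rewrite eqn_leq rk_cat_le /=.
  by have := rk_cons_le R w (S ++ L ++ ws); rewrite rkSLw' addnS.
have pos2 := IH (w :: S) L L_free (etrans rkSLw' (addnS _ _)).
apply: eq_positive_expansion
  (positive_expansionS (IH S L L_free rkSL) pos2) => n.
by rewrite /= mid app_eop_bop.
Qed.

(** Deletion-contraction starts with [S] and [L] empty. Full dimension makes the rank of the
    generators [d], the degree in which the h*-coefficients are taken. *)
Lemma lattice_zonotope_expansion (Z : set 'rV[R]_d) :
  lattice_zonotope Z -> has_dim Z d ->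
  exists c : nat -> G, (forall k, 0 <= c k) /\
    forall i, hstar phi Z d i = \sum_(k < d.+1) c k *~ (eul d k)`_i.
Proof.
move=> [m [v [w [v_int w_int ZE]]]] Z_dim.
pose u (i : 'I_m) : Vint := \row_j Num.floor (v i 0 j).
pose us := map u (enum 'I_m).
have uE i : real_row R (u i) = v i.
  by apply/rowP => j; rewrite !mxE floorK //; apply: v_int.
have {}ZE : Z = translate w (zono (map (@real_row R d) us)).
  rewrite ZE -map_comp zono_family ?enum_uniq //.
  apply/seteqP; split=> x /=.
    move=> [a [a01 ->]]; exists (\sum_i a i *: v i); last exact: addrC.
    exists a; split=> //; rewrite big_enum /=.
    by apply: eq_bigr => i _; rewrite /= uE.
  move=> [y [a [a01 ->]] <-]; exists a; split=> //; rewrite addrC big_enum /=.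
  by congr (_ + _); apply: eq_bigr => i _; rewrite uE.
have rkd : rk us = d by rewrite ZE in Z_dim; apply: zono_full_dim Z_dim.
have := @deletion_contraction us [::] [::]; rewrite /= rkd nil_free.
case=> // c [c_ge0 cE]; exists c; split=> // i.
rewrite hstar_bdiff -(bdiff_cube_expansion _ cE); apply: eq_iter_bdiff => n.
rewrite -(val_dilate_zono phi_val) ZE.
have -> : dilate n (translate w (zono (map (@real_row R d) us))) =
    translate (n%:R *: w) (dilate n (zono (map (@real_row R d) us))).
  apply/seteqP; split=> x.
    move=> [_ [y yZ <-] <-]; exists (n%:R *: y); first by exists y.
    by rewrite scalerDr.
  move=> [_ [y yZ <-] <-]; exists (y + w); first by exists y.
  by rewrite scalerDr.
apply: valuation_translate => //; last first.
  by move=> j; rewrite mxE rpredM ?natr_int ?w_int.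
rewrite dilate_zono; apply: lattice_hull_zono => _ /mapP[x /mapP[y _ ->] ->] j.
by rewrite !mxE rpredM ?natr_int ?intr_int.
Qed.

Lemma eul_comb_le (c : nat -> G) r i j : (forall k, 0 <= c k) ->
  (forall k, (k <= r)%N -> (eul r k)`_i <= (eul r k)`_j) ->
  \sum_(k < r.+1) c k *~ (eul r k)`_i <= \sum_(k < r.+1) c k *~ (eul r k)`_j.
Proof.
move=> c_ge0 le_ij; rewrite -order_subr_ge0 -sumrB; apply: order_sumr_ge0 => k.
rewrite -mulrzBr; have := le_ij k; rewrite -ltnS ltn_ord => /(_ isT).
(* The integer multiplier is nonnegative, so the multiple is a repeated sum of [c k]. *)
rewrite -subr_ge0; case: (_ - _) => // m _; elim: m => [|m IHm].
  by rewrite mulr0z.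
by rewrite intS mulrzDr mulr1z order_addr_ge0.
Qed.

End CombinatoriallyPositive.

Lemma real_hstar_real_rooted (R : realType) (d : nat) (Z : set 'rV[R]_d)
    (phi : set 'rV[R]_d -> R) :
  lattice_zonotope Z -> has_dim Z d -> combinatorially_positive phi ->
  real_rooted (hstar_poly phi Z d).
Proof.
move=> Z_zonotope Z_dim phi_pos.
have R_order : translation_invariant_order R by move=> x y z; rewrite lerD2r.
have [c [c_ge0 hE]] := lattice_zonotope_expansion R_order phi_pos Z_zonotope Z_dim.
suff -> : hstar_poly phi Z d = \sum_(k < d.+1) c k *: map_poly intr (eul d k).
  exact: eul_comb_real_rooted.
apply/polyP => i; rewrite coef_poly coef_sum.
under [RHS]eq_bigr do rewrite coefZ coef_map_id0 //.
have [_|lt_di] := ltnP i d.+1.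
  by rewrite hE; apply: eq_bigr => k _; rewrite mulrzr.
by rewrite big1 // => k _; rewrite eul_oversize // mulr0z mulr0.
Qed.

Unset Implicit Arguments.

Theorem theorem1p2 (R : realType) (d : nat) (Z : set 'rV[R]_d)
    (Z_zonotope : lattice_zonotope Z) (Z_dim : has_dim Z d) :
  (forall phi : set 'rV[R]_d -> R,
     combinatorially_positive phi -> real_rooted (hstar_poly phi Z d)) /\
  (forall (G : porderZmodType) (phi : set 'rV[R]_d -> G),
     translation_invariant_order G ->
     combinatorially_positive phi ->
     (~~ odd d ->
        (forall i, (i < d./2)%N -> hstar phi Z d i <= hstar phi Z d i.+1) /\
        (forall i, (d./2 <= i < d)%N -> hstar phi Z d i.+1 <= hstar phi Z d i)) /\
     (odd d ->
        (forall i, (i < d.-1./2)%N -> hstar phi Z d i <= hstar phi Z d i.+1) /\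
        (forall i, (d.+1./2 <= i < d)%N ->
           hstar phi Z d i.+1 <= hstar phi Z d i))).
Proof.
split=> [phi|G phi G_order phi_pos]; first exact: real_hstar_real_rooted.
have [c [c_ge0 hE]] := lattice_zonotope_expansion G_order phi_pos Z_zonotope Z_dim.
have incr i : (i.+1.*2 <= d)%N -> hstar phi Z d i <= hstar phi Z d i.+1.
  by move=> le_i; rewrite !hE; apply: eul_comb_le => // k ?; apply: eul_incr.
have decr i : (d <= i.*2)%N -> (i < d)%N ->
    hstar phi Z d i.+1 <= hstar phi Z d i.
  move=> le_i lt_i; rewrite !hE; apply: eul_comb_le => // k ?.
  exact: eul_decr_coef.
(* For either parity the index ranges imply [2 (i + 1) <= d] on the rising side and [d <= 2 i] on
   the falling side. *)
have := odd_double_half d.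
split=> d_parity; split=> i Hi; [apply: incr|apply: decr|apply: incr|apply: decr];
  lia.
Qed.
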